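(* Let $\Omega$ be a bounded open subset of $\mathbb{R}^n$, let $\mathbf{X}$ be a continuous random vector with values in $\Omega$ and probability density function $f_{\mathbf{X}}$, let $Y=g(\mathbf{X})$ with $g\in C^1(\overline{\Omega},\mathbb{R})$, and let $d\ge0$. Then $$\mathrm{PEACE}_d^{\mathrm{dis}}(\mathbf{X}\to Y)=\mathrm{PEACE}_d(\mathbf{X}\to Y)=\int_{\Omega}|\nabla g|\,f_{\mathbf{X}}^{2d}\,\mathrm{d}\mathbf{x}.$$
   Context: $|\cdot|$ is the Euclidean norm; $C^1_c(\Omega,\mathbb{R}^n)$ is the set of compactly supported continuously differentiable functions $\Omega\to\mathbb{R}^n$; $C^1(\overline\Omega,\mathbb R)$ is the set of functions $\overline\Omega\to\mathbb{R}$ whose first-order derivatives exist and are continuous. Continuous PEACE: $$\mathrm{PEACE}_d(\mathbf{X}\to Y):=\sup\left\{\int_{\Omega} g\,\mathrm{div}(\varphi)\,\mathrm{d}\mathbf{x}:\ \varphi\in C_c^1(\Omega,\mathbb{R}^n),\ |\varphi|\le f_{\mathbf{X}}^{2d}\right\}.$$ Discrete-like PEACE. An admissible compact cover of $\Omega$ is a sequence $\{C_j\}_{j\ge0}$ of rectifiable compact subsets of $\Omega$ with piecewise $C^1$ boundaries, $C_j\subseteq\mathrm{Int}(C_{j+1})$ and $\Omega=\bigcup_j C_j$ (rectifiable: bounded with boundary of Lebesgue measure $0$); fix one. Let $\varphi=(\varphi^{(1)},\dots,\varphi^{(n)})\in C_c^1(\Omega,\mathbb{R}^n)$ with $|\varphi|\le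 f_{\mathbf{X}}^{2d}$. Choose $j$ with $\mathrm{Supp}(\varphi)\subseteq C_j$ and a cell $C=\prod_{i=1}^n[a_i,b_i]\supseteq C_j$. Let $\widetilde g,\widetilde\varphi$ be the extensions of $g|_\Omega$, $\varphi$ by $0$ outside $\Omega$. A partition $P$ of $C$ is a product $P=\prod_{i=1}^n\{x_{i0}<\dots<x_{in_i}\}$ with $x_{i0}=a_i$, $x_{in_i}=b_i$; for $1\le j_i\le n_i$ it has discrete-like cubes $Q_{j_1,\dots,j_n}=\prod_{i}\{x_{i,j_i-1},x_{i,j_i}\}$ (sets of $2^n$ vertices), and $\|P\|$ is the maximum of their diameters. Put $\Delta x_{kj_k}=x_{kj_k}-x_{k,j_k-1}$ and $$\mathrm{dif}^{(i)}_{j_1,\dots,j_n}=\frac1{2^{n-1}}\sum_{\mathbf{v}}\bigl(\widetilde g(\mathbf{v})-\widetilde g(\mathbf{v}')\bigr),$$ where $\mathbf{v}$ runs over the $2^{n-1}$ points of $Q_{j_1,\dots,j_n}$ with $v_i=x_{i,j_i}$, and $\mathbf{v}'$ is obtained from $\mathbf{v}$ by replacing the $i$-th coordinate by $x_{i,j_i-1}$. For arbitrary points $\mathbf{x}^{(P)}_{j_1,\dots,j_n}\in Q_{j_1,\dots,j_n}$ let $$\mathrm{PEACE}_d^{\varphi,\mathrm{dis}}(\mathbf{X}\to Y):=\lim_{\|P\|\to0}\ \sum_{j_1,\dots,j_n}\ \sum_{i=1}^n\mathrm{dif}^{(i)}_{j_1,\dots,j_n}\,\widetilde\varphi^{(i)}(\mathbf{x}^{(P)}_{j_1,\dots,j_n})\prod_{k\ne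 i}\Delta x_{kj_k}$$ (for continuously differentiable $g$ this is well defined, independently of the chosen points and of the cover). Finally $$\mathrm{PEACE}_d^{\mathrm{dis}}(\mathbf{X}\to Y):=\sup_{\varphi}\mathrm{PEACE}_d^{\varphi,\mathrm{dis}}(\mathbf{X}\to Y),$$ the supremum over all $\varphi\in C_c^1(\Omega,\mathbb{R}^n)$ with $|\varphi|\le f_{\mathbf{X}}^{2d}$.
   Formalization: For d > 0 the density f_X is additionally assumed lower semicontinuous at almost every point of Ω; for an arbitrary density the formula fails (f_X the normalized indicator of a closed nowhere dense set of positive measure, g = x_1). *)

(* Defs.v *)
From HB Require Import structures.
From mathcomp Require Import all_boot all_order all_algebra.
From mathcomp Require Import all_classical all_reals all_analysis.
Set Implicit Arguments.
Unset Strict Implicit.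
Unset Printing Implicit Defensive.
Import Order.TTheory GRing.Theory Num.Theory.
Import numFieldNormedType.Exports.
Local Open Scope classical_set_scope.
Local Open Scope ring_scope.

(* Row vectors carry the sigma-algebra generated by the coordinates, exactly as
   the library does for tuples; it is the Borel sigma-algebra of R^n. *)
Definition measure_rV_display : measure_display.
Proof. exact. Qed.

Section measurable_rV.
Context {R : realType} (n : nat).

Let coors : 'I_n -> 'rV[R]_n -> R := fun i x => x ord0 i.

Let rV_set0 : g_sigma_preimage coors set0.
Proof. exact: sigma_algebra0. Qed.

Let rV_setC A : g_sigma_preimage coors A -> g_sigma_preimage coors (~` A).
Proof. exact: sigma_algebraC. Qed.

Let rV_bigcup (F : (set 'rV[R]_n)^nat) :
  (forall i, g_sigma_preimage coors (F i)) ->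
  g_sigma_preimage coors (\bigcup_i (F i)).
Proof. exact: sigma_algebra_bigcup. Qed.

HB.instance Definition _ := @isMeasurable.Build measure_rV_display
  'rV[R]_n (g_sigma_preimage coors) rV_set0 rV_setC rV_bigcup.

End measurable_rV.

Lemma measurable_coord (R : realType) n (i : 'I_n) :
  measurable_fun [set: 'rV[R]_n] (fun x : 'rV[R]_n => x ord0 i).
Proof.
move=> _ Y mY; rewrite setTI; apply: sub_sigma_algebra => /=.
rewrite -bigcup_seq/=; exists i => /=; first by rewrite mem_index_enum.
by exists Y => //; rewrite setTI.
Qed.

Lemma measurable_fun_rV d (T : measurableType d) (R : realType) n
    (f : T -> 'rV[R]_n) :
  (forall i, measurable_fun [set: T] (fun x => f x ord0 i)) ->
  measurable_fun [set: T] f.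
Proof.
move=> mf.
suff : g_sigma_preimage (fun i x => f x ord0 i) `<=` measurable.
  rewrite (@g_sigma_preimage_comp _ _ _ _
    (fun (i : 'I_n) (x : 'rV[R]_n) => x ord0 i) _ f) => fS _ A mA.
  by apply: fS; exists A.
apply: smallest_sub; first exact: sigma_algebra_measurable.
case: n => [|n] in f mf *; first by rewrite big_ord0.
rewrite -bigcup_mkord_ord; apply: bigcup_sub => i Ii.
by move=> A [B mB <-]; exact: mf.
Qed.

(* Lebesgue measure on R^n: the image of lebesgue_measure \x lebesgue_rV n
   under the identification of R * R^n with R^(n+1). *)
Definition rV_cons (R : realType) n (p : R * 'rV[R]_n) : 'rV[R]_n.+1 :=
  row_mx p.1%:M p.2.

Lemma rV_cons0 (R : realType) n (p : R * 'rV[R]_n) : rV_cons p ord0 ord0 = p.1.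
Proof.
rewrite mxE; case: splitP => [j _|j //]; by rewrite mxE !ord1 eqxx.
Qed.

Lemma rV_consS (R : realType) n (p : R * 'rV[R]_n) i :
  rV_cons p ord0 (lift ord0 i) = p.2 ord0 i.
Proof.
rewrite mxE; case: splitP => [j|j]; first by rewrite ord1.
by rewrite lift0 add1n => -[/val_inj ->].
Qed.

Lemma measurable_rV_cons (R : realType) n :
  measurable_fun [set: measurableTypeR R * 'rV[R]_n] (@rV_cons R n).
Proof.
apply: measurable_fun_rV => i; case: (unliftP ord0 i) => [j ->|->].
  rewrite (_ : (fun _ => _) = (fun x : 'rV[R]_n => x ord0 j) \o snd).
    by apply: measurableT_comp => //; exact: measurable_coord.
  by apply/funext => p /=; rewrite rV_consS.
rewrite (_ : (fun _ => _) = fst); first exact: measurable_fst.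
by apply/funext => p /=; rewrite rV_cons0.
Qed.

Section lebesgue_step.
Context (R : realType) (n : nat).
Variable mu : {sigma_finite_measure set 'rV[R]_n -> \bar R}.

Definition lebesgue_step : set 'rV[R]_n.+1 -> \bar R :=
  pushforward (lebesgue_measure \x mu)%E (@rV_cons R n).

Let lebesgue_step0 : lebesgue_step set0 = 0%E.
Proof. by rewrite /lebesgue_step /pushforward preimage_set0 measure0. Qed.

Let lebesgue_step_ge0 A : (0 <= lebesgue_step A)%E.
Proof. by rewrite /lebesgue_step /pushforward measure_ge0. Qed.

Let lebesgue_step_additive : semi_sigma_additive lebesgue_step.
Proof.
move=> F mF tF mUF; rewrite /lebesgue_step /pushforward preimage_bigcup.
apply: measure_semi_sigma_additive.
- by move=> k; rewrite -[X in measurable X]setTI; exact: measurable_rV_cons.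
- apply/trivIsetP => /= i j _ _ ij; rewrite -preimage_setI.
  by move/trivIsetP : tF => /(_ _ _ _ _ ij) ->//; rewrite preimage_set0.
- rewrite -preimage_bigcup -[X in measurable X]setTI.
  exact: measurable_rV_cons.
Qed.

HB.instance Definition _ := isMeasure.Build _ _ _ lebesgue_step
  lebesgue_step0 lebesgue_step_ge0 lebesgue_step_additive.

Let lebesgue_step_sigma_finite : sigma_finite setT lebesgue_step.
Proof.
have /sigma_finiteP[F' [TF' ndF' Foo']] := sigma_finiteT (@lebesgue_measure R).
have /sigma_finiteP[G [TG ndG Goo]] := sigma_finiteT mu.
pose tl (x : 'rV[R]_n.+1) : 'rV[R]_n := \row_i x ord0 (lift ord0 i).
have tl_cons p : tl (rV_cons p) = p.2.
  by apply/rowP => i; rewrite mxE rV_consS.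
have mtl : measurable_fun setT tl.
  apply: measurable_fun_rV => i; rewrite (_ : (fun _ => _) =
    (fun x : 'rV[R]_n.+1 => x ord0 (lift ord0 i))).
    exact: measurable_coord.
  by apply/funext => x; rewrite mxE.
exists (fun k => (fun x : 'rV[R]_n.+1 => x ord0 ord0) @^-1` F' k `&`
                 tl @^-1` G k).
  rewrite predeqE => x; split => // _.
  have : setT (x ord0 ord0) by [].
  rewrite TF' => -[i _ Fi]; have : setT (tl x) by []; rewrite TG => -[j _ Gj].
  exists (maxn i j) => //; split => /=.
  - by move: (x ord0 ord0) Fi; exact/subsetPset/ndF'/leq_maxl.
  - by move: (tl x) Gj; exact/subsetPset/ndG/leq_maxr.
move=> k; have [? ?] := Foo' k; have [? ?] := Goo k; split.
  apply: measurableI.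
    by rewrite -[X in measurable X]setTI; exact: measurable_coord.
  by rewrite -[X in measurable X]setTI; exact: mtl.
rewrite /lebesgue_step /pushforward (_ : _ @^-1` _ = F' k `*` G k).
  by rewrite product_measure1E// lte_mul_pinfty// ge0_fin_numE.
by rewrite predeqE => -[x y]; split=> -[] /=; rewrite rV_cons0 tl_cons.
Qed.

HB.instance Definition _ := Measure_isSigmaFinite.Build _ _ _ lebesgue_step
  lebesgue_step_sigma_finite.

End lebesgue_step.

Fixpoint lebesgue_rV (R : realType) n :
    {sigma_finite_measure set 'rV[R]_n -> \bar R} :=
  if n is m.+1 then lebesgue_step (lebesgue_rV R m) else dirac (0 : 'rV[R]_0).

Definition cell (R : realType) n (a b : 'rV[R]_n) : set 'rV[R]_n :=
  [set x | forall i, a ord0 i <= x ord0 i <= b ord0 i].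

Lemma lebesgue_rV_cell (R : realType) n (a b : 'rV[R]_n) :
  (forall i, a ord0 i <= b ord0 i) ->
  lebesgue_rV R n (cell a b) = (\prod_i (b ord0 i - a ord0 i))%:E.
Proof.
elim: n => [|n IH] in a b *.
  move=> _; rewrite big_ord0 /= diracE mem_set//.
  by case.
move=> ab.
pose tl (x : 'rV[R]_n.+1) : 'rV[R]_n := \row_i x ord0 (lift ord0 i).
rewrite /= /lebesgue_step /pushforward.
have -> : @rV_cons R n @^-1` cell a b =
    `[a ord0 ord0, b ord0 ord0]%classic `*` cell (tl a) (tl b).
  rewrite predeqE => -[x y]; split=> /=.
    move=> abxy; split=> /=.
      by have := abxy ord0; rewrite rV_cons0 in_itv.
    by move=> i; have := abxy (lift ord0 i); rewrite rV_consS !mxE.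
  rewrite in_itv /= => -[abx aby] i; case: (unliftP ord0 i) => [j ->|->].
    by have := aby j; rewrite rV_consS !mxE.
  by rewrite rV_cons0.
rewrite product_measure1E//; last first.
  rewrite (_ : cell _ _ = \bigcap_i ((fun x : 'rV[R]_n => x ord0 i) @^-1`
      `[tl a ord0 i, tl b ord0 i]%classic)); last first.
    rewrite predeqE => x; split => /= [h i _|h i]; first by rewrite /= in_itv/=.
    by have := h i I; rewrite /= in_itv.
  apply: fin_bigcap_measurable; first exact: finite_finset.
  move=> i _; rewrite -[X in measurable X]setTI.
  exact: measurable_coord.
rewrite IH; last by move=> i; rewrite !mxE.
rewrite [X in (X * _)%E]lebesgue_measure_itv /= lte_fin big_ord_recl EFinM.
congr (_ * _)%E.
  rewrite EFinB; case: ltP => // ba.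
  have -> : a ord0 ord0 = b ord0 ord0 by apply/le_anti; rewrite ab ba.
  by rewrite -EFinB subrr.
by congr EFin; apply: eq_bigr => i _; rewrite !mxE.
Qed.

Section Calculus.
Context {R : realType} {n : nat}.
Implicit Types (U W : set 'rV[R]_n) (x y : 'rV[R]_n).

(* The library norm `|x| on 'rV[R]_n is the sup norm. *)
Definition enorm (v : 'rV[R]_n) : R := Num.sqrt (\sum_i v ord0 i ^+ 2).

Definition partial (V : normedModType R) (h : 'rV[R]_n -> V) (i : 'I_n) x : V :=
  'D_(delta_mx ord0 i) h x.

(* To be used with U open; h is unconstrained outside U. *)
Definition C1 (V : normedModType R) U (h : 'rV[R]_n -> V) : Prop :=
  forall i x, U x ->
    derivable h x (delta_mx ord0 i) /\ {for x, continuous (partial h i)}.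

(* At boundary points the derivatives are understood as continuous extensions
   of the derivatives in W. *)
Definition C1_closure W (g : 'rV[R]_n -> R) : Prop :=
  [/\ C1 W g, {within closure W, continuous g} &
      forall i, exists2 G : 'rV[R]_n -> R,
        {within closure W, continuous G} &
        forall x, W x -> G x = partial g i x].

Definition grad (g : 'rV[R]_n -> R) x : 'rV[R]_n := \row_i partial g i x.

Definition div (phi : 'rV[R]_n -> 'rV[R]_n) x : R :=
  \sum_i partial (fun y => phi y ord0 i) i x.

(* Functions on W are represented by total functions whose values outside W are
   irrelevant. *)
Definition supp W (phi : 'rV[R]_n -> 'rV[R]_n) : set 'rV[R]_n :=
  closure [set x | W x /\ phi x != 0].

Definition C1c W (phi : 'rV[R]_n -> 'rV[R]_n) : Prop :=
  [/\ C1 W phi, compact (supp W phi) & supp W phi `<=` W].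

Definition ext0 (V : zmodType) W (h : 'rV[R]_n -> V) : 'rV[R]_n -> V :=
  patch (fun=> 0) W h.

Definition frontier U : set 'rV[R]_n := closure U `\` interior U.

Definition rectifiable U : Prop :=
  bounded_set U /\ lebesgue_rV R n (frontier U) = 0%E.

End Calculus.

(* A finite union of C^1 images of the cell [0, 1]^(n-1); for n = 1 this is a
   finite set of points.  The parametrisations need not be injective or
   regular. *)
Definition piecewise_C1 (R : realType) n (B : set 'rV[R]_n) : Prop :=
  exists (m : nat) (gamma : 'I_m -> 'rV[R]_n.-1 -> 'rV[R]_n),
    (forall k, C1 setT (gamma k)) /\ B = \bigcup_k (gamma k @` cell 0 (const_mx 1)).

Definition admissible_cover (R : realType) n (W : set 'rV[R]_n)
    (C : (set 'rV[R]_n)^nat) : Prop :=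
  (forall j, [/\ compact (C j), rectifiable (C j),
                 piecewise_C1 (frontier (C j)) &
                 C j `<=` interior (C j.+1)]) /\
  W = \bigcup_j C j.


Section Partitions.
Context {R : realType} {n : nat}.
(* x_{i,k} is the k-th entry of a_i :: s i, for 0 <= k <= size (s i) *)
Variables (a b : 'rV[R]_n) (s : 'I_n -> seq R).

Definition is_partition : Prop :=
  forall i, itv_partition (a ord0 i) (b ord0 i) (s i).

Definition node (i : 'I_n) (k : nat) : R :=
  nth (b ord0 i) (a ord0 i :: s i) k.

(* 0-based: j stands for the multi-index (j_1 + 1, ..., j_n + 1) *)
Definition cube := {dffun forall i : 'I_n, 'I_(size (s i))}.

(* The vertices of a cube are indexed by the set e of the coordinates at which
   the right endpoint is taken. *)
Definition vertex (j : cube) (e : {set 'I_n}) : 'rV[R]_n :=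
  \row_i node i (j i + (i \in e)).

Definition dcube (j : cube) : set 'rV[R]_n := range (vertex j).

Definition width (j : cube) (i : 'I_n) : R := node i (j i).+1 - node i (j i).

Definition mesh : R :=
  \big[Num.max/0]_(j : cube) \big[Num.max/0]_(e : {set 'I_n})
    \big[Num.max/0]_(e' : {set 'I_n}) enorm (vertex j e - vertex j e').

Definition dif (g : 'rV[R]_n -> R) (i : 'I_n) (j : cube) : R :=
  (2 ^+ n.-1)^-1 *
  \sum_(e : {set 'I_n} | i \in e) (g (vertex j e) - g (vertex j (e :\ i))).

Definition dis_sum (g : 'rV[R]_n -> R) (phi : 'rV[R]_n -> 'rV[R]_n)
    (tag : cube -> 'rV[R]_n) : R :=
  \sum_(j : cube) \sum_i
    dif g i j * phi (tag j) ord0 i * \prod_(k | k != i) width j k.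

End Partitions.

Section PEACE.
Context {R : realType} {n : nat}.
Variables (Omega : set 'rV[R]_n) (f g : 'rV[R]_n -> R) (d : R).

(* powR satisfies 0 `^ 0 = 1, so the bound is 1 when d = 0 *)
Definition admissible : set ('rV[R]_n -> 'rV[R]_n) :=
  [set phi | C1c Omega phi /\
             forall x, Omega x -> enorm (phi x) <= f x `^ (2 * d)].

Definition PEACE : \bar R :=
  ereal_sup [set (\int[lebesgue_rV R n]_(x in Omega) (g x * div phi x)%:E)%E
            | phi in admissible].

(* l is the limit of the sums as the mesh tends to 0, whatever the choice of
   the set of the cover, of the cell and of the points of the cubes *)
Definition is_PEACE_dis (C : (set 'rV[R]_n)^nat) (phi : 'rV[R]_n -> 'rV[R]_n)
    (l : R) : Prop :=
  forall k (a b : 'rV[R]_n), supp Omega phi `<=` C k -> (forall i, a ord0 i < b ord0 i) ->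
    C k `<=` cell a b ->
  forall eps, 0 < eps -> exists2 delta, 0 < delta &
    forall (s : 'I_n -> seq R) (tag : cube s -> 'rV[R]_n),
      is_partition a b s -> (forall j, dcube a b j (tag j)) ->
      mesh a b s < delta ->
      `|dis_sum a b (ext0 Omega g) (ext0 Omega phi) tag - l| < eps.

Definition PEACE_dis_of (C : (set 'rV[R]_n)^nat)
    (phi : 'rV[R]_n -> 'rV[R]_n) : R :=
  xget 0 [set l | is_PEACE_dis C phi l].

Definition PEACE_dis (C : (set 'rV[R]_n)^nat) : \bar R :=
  ereal_sup [set (PEACE_dis_of C phi)%:E | phi in admissible].

End PEACE.

Definition is_pdf d (T : measurableType d) (R : realType) n
    (P : probability T R) (X : {RV P >-> 'rV[R]_n}) (f : 'rV[R]_n -> R) : Prop :=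
  [/\ measurable_fun setT f, (forall x, 0 <= f x) &
      forall A, measurable A ->
        distribution P X A = (\int[lebesgue_rV R n]_(x in A) (f x)%:E)%E].

(* A continuous field bounded by f `^ (2 * d) at every point is also bounded by
   the lower semicontinuous envelope of f `^ (2 * d), so PEACE can only see that
   envelope: a density that differs from its envelope on a set of positive
   measure (the indicator of a fat Cantor set) breaks the integral formula. *)
Definition lsc_at (R : realType) n (f : 'rV[R]_n -> R) (x : 'rV[R]_n) : Prop :=
  forall t, t < f x -> \forall y \near x, t < f y.

(* Main.v *)
(* For a field phi in C^1_c, write <phi> for the integral of grad g . phi.

   Both suprema are suprema of <phi>. The discrete sums are Riemann sums of
   grad g . phi up to an error controlled by the mean value theorem along the
   edges of the cubes and by uniform continuity. The divergence integral equals
   -<phi>, because the integral of the i-th derivative of the compactly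
   supported function g phi_i is a limit of sums over a uniform grid that
   telescope to 0; and phi may be replaced by -phi.

   That <phi> is at most the integral of |grad g| f^(2d) is Cauchy-Schwarz. For
   the converse, cut Omega into grid cubes of side 1/N and let phi be, on each
   cube Q contained in Omega, the infimum of f^(2d) over Q, times the direction
   of grad g at a corner of Q, times a bump supported inside Q. When the bumps
   fill the cubes and then N tends to infinity, grad g . phi has lower limit at
   least |grad g| f^(2d) at every point of lower semicontinuity of f with
   irrational coordinates, so Fatou's lemma, applied twice, concludes. *)

Require Import Defs.
From mathcomp Require Import all_boot all_order all_algebra.
From mathcomp Require Import all_classical all_reals all_analysis measurable_realfun.
From mathcomp Require Import ring lra.
Set Implicit Arguments.
Unset Strict Implicit.
Unset Printing Implicit Defensive.
Import Order.TTheory GRing.Theory Num.Theory.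
Import numFieldNormedType.Exports.
Local Open Scope classical_set_scope.
Local Open Scope ring_scope.

(** * Topology and measure on row vectors *)

(** Two obstacles shape the argument. The extension of [g] by 0 jumps at the frontier of [Omega], so
    the mean value theorem fails on cubes that meet it. Once the mesh is small against the distance
    from the support of [phi] to the complement of [Omega], a cube with its tag in the support lies
    in [Omega], and a cube with its tag elsewhere contributes 0 whatever the jump. The second
    obstacle is that the extremal field, f^(2d) times the direction of grad g, is far from C^1: [f]
    is only measurable and grad g only continuous. Both are therefore frozen on each grid cube, and
    the bump alone carries the smoothness. An infimum over the cube keeps the pointwise bound
    without any regularity of [f], and lower semicontinuity recovers the value in the limit. The two
    limits are iterated because the position of a point inside its cube changes with N: at each N
    the bump reaches 1 there only for a small enough margin. *)

Section RowVectors.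
Context {R : realType} {n : nat}.
Implicit Types (x y : 'rV[R]_n).

Lemma coord_le_norm x i : `|x ord0 i| <= `|x|.
Proof.
rewrite [leRHS]/Num.Def.normr /= mx_normrE.
by apply: le_trans (le_bigmax _ _ (ord0, i)).
Qed.

Lemma norm_lt_coord x e : 0 < e -> (forall i, `|x ord0 i| < e) -> `|x| < e.
Proof.
move=> e0 xe; rewrite [ltLHS]/Num.Def.normr /= mx_normrE.
by apply/bigmax_lt => // -[i j] _ /=; rewrite ord1.
Qed.

Lemma continuous_coord i : continuous (fun x => x ord0 i).
Proof. exact: coord_continuous. Qed.

Lemma nbhs_rVP x (U : set 'rV[R]_n) : nbhs x U <->
  exists2 e, 0 < e & forall y, (forall i, `|x ord0 i - y ord0 i| < e) -> U y.
Proof.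
split.
  move=> /nbhs_ballP[e /= e0 xU]; exists e => // y xy; apply: xU.
  rewrite -ball_normE /ball_ /=; apply: norm_lt_coord => // i.
  by rewrite !mxE.
move=> [e e0 xU]; apply/nbhs_ballP; exists e => //= y.
rewrite -ball_normE /ball_ /= => xy; apply: xU => i.
by apply: le_lt_trans xy; have := coord_le_norm (x - y) i; rewrite !mxE.
Qed.

Lemma bounded_rVP (U : set 'rV[R]_n) : bounded_set U ->
  exists2 M, 0 < M & forall x, U x -> forall i, `|x ord0 i| < M.
Proof.
move=> /pinfty_ex_gt0[M M0 UM]; exists (M + 1); first by rewrite addr_gt0.
move=> x Ux i; apply: (@le_lt_trans _ _ M); last by rewrite ltrDl.
by apply: le_trans (coord_le_norm _ _) _; exact: UM.
Qed.

Definition box (A : 'I_n -> set R) : set 'rV[R]_n :=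
  [set x | forall i, A i (x ord0 i)].

Lemma measurable_box (A : 'I_n -> set R) :
  (forall i, measurable (A i)) -> measurable (box A).
Proof.
move=> mA; rewrite (_ : box A =
    \bigcap_i ((fun x : 'rV[R]_n => x ord0 i) @^-1` A i)); last first.
  by rewrite predeqE => x; split => /= [h i _|h i]; [exact: h|exact: h i I].
apply: fin_bigcap_measurable; first exact: finite_finset.
move=> i _; rewrite -[X in measurable X]setTI.
exact: measurable_coord.
Qed.

(** The sigma-algebra is generated by the coordinates, so an open set is exhausted by the countably
    many boxes with rational centre and half-width that it contains. *)
Lemma open_measurable_rV (U : set 'rV[R]_n) : open U -> measurable U.
Proof.
move=> oU.
pose B (p : 'rV[rat]_n * rat) : set 'rV[R]_n :=
  box (fun i => `]ratr (p.1 ord0 i) - ratr p.2, ratr (p.1 ord0 i) + ratr p.2[%classic).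
have mB p : measurable (B p) by apply: measurable_box => i; exact: measurable_itv.
pose F p : set 'rV[R]_n := if `[< B p `<=` U >] then B p else set0.
have -> : U = \bigcup_p F p.
  rewrite predeqE => x; split; last first.
    by move=> [p _]; rewrite /F; case: asboolP => // /[apply].
  move=> Ux; have /nbhs_rVP[e e0 xU] : nbhs x U by exact: open_nbhs_nbhs.
  (* The centre is within [r] of [x] and the points of the box within [r] of the centre, hence 2r <
     e. *)
  have [r /=] := @rat_in_itvoo R 0 (e / 2) (divr_gt0 e0 (ltr0Sn _ 1)).
  rewrite in_itv/= => /andP[r0 re].
  have qx i : {q : rat | ratr q \in `]x ord0 i - ratr r, x ord0 i + ratr r[}.
    have : x ord0 i - ratr r < x ord0 i + ratr r by rewrite ltrD2l gtrN.
    by move=> /rat_in_itvoo h; apply: cid; case: h => q h; exists q.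
  exists (\row_i sval (qx i), r) => //; rewrite /F.
  case: asboolP => [_|[]].
    move=> i /=; rewrite !mxE in_itv/=; case: (qx i) => q /=.
    by rewrite in_itv /= ltrBlDr ltrBlDr => /andP[-> ->].
  move=> y By; apply: xU => i; have := By i; rewrite /= !mxE.
  case: (qx i) => q /=; rewrite !in_itv /= => /andP[h1 h2] /andP[h3 h4].
  by rewrite ltr_distl; apply/andP; split; lra.
apply: countable_bigcupT_measurable => // p; rewrite /F.
by case: ifP => // _; exact: measurable0.
Qed.

Lemma measurable_fun_continuous (U : set 'rV[R]_n) (h : 'rV[R]_n -> R) :
  open U -> (forall x, U x -> {for x, continuous h}) -> measurable_fun U h.
Proof.
move=> oU ch; have mU := open_measurable_rV oU.
apply: (measurability _ (measurable_realfun.RGenOpens.measurableE R)) => _ [_ [a [b ->]] <-].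
apply: open_measurable_rV; rewrite openE => x [Ux /=] hx.
apply: filterI; first exact: open_nbhs_nbhs.
apply: (ch x Ux); apply: open_nbhs_nbhs; split => //.
Qed.

End RowVectors.

Lemma lebesgue_rV_box (R : realType) n (A : 'I_n -> set R) (w : 'I_n -> R) :
  (forall i, measurable (A i)) ->
  (forall i, lebesgue_measure (A i) = (w i)%:E) ->
  lebesgue_rV R n (box A) = (\prod_i w i)%:E.
Proof.
elim: n => [|n IH] in A w *.
  by move=> _ _; rewrite big_ord0 /= diracE mem_set// => -[].
move=> mA wA; rewrite /= /lebesgue_step /pushforward.
have -> : @rV_cons R n @^-1` box A =
    A ord0 `*` box (fun i => A (lift ord0 i)).
  rewrite predeqE => -[x y]; split=> /=.
    move=> Axy; split=> /=; first by have := Axy ord0; rewrite rV_cons0.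
    by move=> i; have := Axy (lift ord0 i); rewrite rV_consS.
  move=> [Ax Ay] i; case: (unliftP ord0 i) => [j ->|->]; last by rewrite rV_cons0.
  by rewrite rV_consS; exact: Ay.
rewrite product_measure1E//; last by apply: measurable_box.
rewrite (IH _ (fun i => w (lift ord0 i)))// big_ord_recl EFinM; congr (_ * _)%E.
exact: wA.
exact: mA.
Qed.

(** The product formula wants finite side measures, so the other coordinates are cut to [-k, k]; the
    slab is a countable union of these null boxes. *)
Lemma lebesgue_rV_null (R : realType) n (i : 'I_n) (D : set R) :
  measurable D -> lebesgue_measure D = 0%E ->
  lebesgue_rV R n [set x | D (x ord0 i)] = 0%E.
Proof.
move=> mD D0.
pose A (k : nat) := box (fun j : 'I_n => if j == i then D else
   `[- k%:R, k%:R]%classic).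
have mA k : measurable (A k).
  by apply: measurable_box => j; case: ifP.
have A0 k : lebesgue_rV R n (A k) = 0%E.
  rewrite (@lebesgue_rV_box _ _ _ (fun j => if j == i then 0 else k%:R *+ 2)).
  - by rewrite (bigD1 i)//= eqxx mul0r.
  - by move=> j; case: ifP.
  - move=> j; case: ifP => _; first exact: D0.
    rewrite lebesgue_measure_itv/= lte_fin; case: ltP => [_|].
      by rewrite -EFinB opprK -mulr2n.
    have k0 : 0 <= k%:R :> R by [].
    rewrite -subr_le0 opprK -mulr2n pmulrn_lle0// => k1.
    by have -> : k%:R = 0 :> R by [apply/le_anti; rewrite k0 k1]; rewrite mul0rn.
apply/eqP; rewrite eq_le measure_ge0 andbT.
rewrite [X in lebesgue_rV _ _ X](_ : _ = \bigcup_k A k); last first.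
  rewrite predeqE => x; split => /=; last first.
    by move=> [k _] /(_ i); rewrite eqxx.
  move=> xi; exists (Num.truncn `|x|).+1 => // j; case: eqP => [->//|_].
  rewrite /= in_itv /= -ler_norml; apply: le_trans (coord_le_norm _ _) _.
  exact/ltW/truncnS_gt.
apply: (le_trans (measure_sigma_subadditive _ _ (bigcup_measurable _) _)) => //.
by rewrite eseries0// => k _ _; rewrite /= A0.
Qed.

(** * Functions of class C^1 *)

Section Lines.
Context {R : realType} {n : nat}.
Implicit Types (x y : 'rV[R]_n) (h : 'rV[R]_n -> R).

Lemma is_derive_line h x v (t : R) : derivable h (t *: v + x) v ->
  is_derive t 1 (fun s : R => h (s *: v + x)) ('D_v h (t *: v + x)).
Proof.
move=> dh.
have E : (fun r : R => r^-1 *: (((fun s : R => h (s *: v + x)) \o shift t) (r *: 1)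
      - h (t *: v + x))) =
    (fun r : R => r^-1 *: ((h \o shift (t *: v + x)) (r *: v) - h (t *: v + x))).
  by apply/funext => r /=; rewrite [r%:A]mulr1 scalerDl addrA.
by apply: DeriveDef; rewrite /derivable /derive E.
Qed.

Lemma MVT_line h x i (w : R) : 0 <= w ->
  (forall s, 0 <= s <= w ->
     derivable h (s *: delta_mx ord0 i + x) (delta_mx ord0 i)) ->
  exists2 s, 0 <= s <= w &
    h (w *: delta_mx ord0 i + x) - h x =
      partial h i (s *: delta_mx ord0 i + x) * w.
Proof.
move=> w0 dh; set e := delta_mx ord0 i.
have dl s : 0 <= s <= w -> is_derive s 1 (fun s : R => h (s *: e + x))
    (partial h i (s *: e + x)).
  by move=> sw; apply: is_derive_line; exact: dh.
have [||s] := @MVT_segment R (fun s : R => h (s *: e + x))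
    (fun s => partial h i (s *: e + x)) 0 w w0.
- by move=> s; rewrite in_itv/= => /andP[s0 sw]; apply: dl; rewrite !ltW.
- apply: derivable_within_continuous => s; rewrite in_itv/= => sw.
  exact: (@ex_derive _ _ _ _ _ _ _ (dl _ sw)).
- by rewrite in_itv/= subr0 scale0r add0r => sw ->; exists s.
Qed.

Lemma delta_lineE (s : R) i x j :
  (s *: delta_mx ord0 i + x) ord0 j = s * (j == i)%:R + x ord0 j.
Proof. by rewrite !mxE eqxx. Qed.

Lemma increment_le h x i (w M : R) :
  (forall s, `|s| <= `|w| ->
     derivable h (s *: delta_mx ord0 i + x) (delta_mx ord0 i) /\
     `|partial h i (s *: delta_mx ord0 i + x)| <= M) ->
  `|h (w *: delta_mx ord0 i + x) - h x| <= M * `|w|.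
Proof.
move=> hM; have [w0|w0] := leP 0 w.
  have [s /andP[s0 sw]|s /andP[s0 sw] ->] := @MVT_line h x i w w0.
    by have [] := hM s _; rewrite // !ger0_norm.
  rewrite normrM ler_wpM2r//.
  by have [] := hM s _; rewrite // !ger0_norm.
(* For w < 0 the segment is traversed from its other end. *)
have w0' : 0 <= - w by rewrite oppr_ge0 ltW.
have E s : s *: delta_mx ord0 i + (w *: delta_mx ord0 i + x) =
    (s + w) *: delta_mx ord0 i + x by rewrite addrA scalerDl.
have sw s : 0 <= s <= - w -> `|s + w| <= `|w|.
  move=> /andP[s0 sw]; rewrite !ler0_norm ?(ltW w0)//; lra.
have [s /sw sw'|s /sw sw'] := @MVT_line h (w *: delta_mx ord0 i + x) i (- w) w0'.
  by rewrite E; have [] := hM _ sw'.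
rewrite !E addNr scale0r add0r => H.
rewrite distrC H normrM normrN ler_wpM2r//.
by have [] := hM _ sw'.
Qed.

(** [C1] only speaks of partial derivatives. Passing from [x] to [y] one coordinate at a time, each
    step changes [h] by at most [M * d], where [M] bounds the partial derivatives near [x]. *)
Lemma C1_continuous (U : set 'rV[R]_n) h : open U -> C1 U h ->
  forall x, U x -> {for x, continuous h}.
Proof.
move=> oU hC1 x Ux.
pose M := 1 + \sum_i `|partial h i x|.
have M0 : 0 < M by rewrite ltr_pwDl// sumr_ge0.
have : \forall y \near x, U y /\ forall i, `|partial h i y| <= M.
  near=> y; split; first by near: y; exact: open_nbhs_nbhs.
  move=> i; move: i; near: y; apply: filter_forall => i.
  have [_ ch] := hC1 i x Ux.
  apply: (@cvgr_norm_le _ _ _ _ _ _ _ ch).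
  rewrite /M (bigD1 i)//= addrCA ltr_pwDr// ?ltr_pwDl// sumr_ge0//.
move=> /nbhs_rVP[e e0 xe].
have bound d : 0 < d -> d < e -> forall y, (forall i, `|x ord0 i - y ord0 i| < d) ->
    `|h y - h x| <= M * d *+ n.
  move=> d0 de y xy.
  (* The first [k] coordinates already come from [y]; every intermediate point stays in the sup-norm
     ball around [x]. *)
  pose z k : 'rV[R]_n := \row_i if (i < k)%N then y ord0 i else x ord0 i.
  have zS (k : 'I_n) : z k.+1 = (y ord0 k - x ord0 k) *: delta_mx ord0 k + z k.
    apply/rowP => j; rewrite delta_lineE !mxE ltnS leq_eqVlt -val_eqE/=.
    by have [/val_inj->|] := eqVneq (j : nat) k; rewrite ?ltnn ?mulr1 ?subrK// mulr0 add0r.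
  have zx k : (k <= n)%N -> `|h (z k) - h x| <= M * d *+ k.
    elim: k => [_|k IH kn].
      rewrite (_ : z 0%N = x) ?subrr ?normr0 ?mulr0n//.
      by apply/rowP => j; rewrite mxE.
    rewrite -(subrKA (h (z k))) (le_trans (ler_normD _ _))// mulrS lerD//; last first.
      exact/IH/ltnW.
    rewrite (zS (Ordinal kn)); apply: le_trans (@increment_le _ _ _ _ M _) _; last first.
      by rewrite ler_pM2l// ltW// distrC.
    move=> s sw /=.
    have [Uz zM] : U (s *: delta_mx ord0 (Ordinal kn) + z k) /\
        forall i, `|partial h i (s *: delta_mx ord0 (Ordinal kn) + z k)| <= M.
      apply: xe => i; rewrite delta_lineE mxE.
      have [->|ik] := eqVneq i (Ordinal kn).
        rewrite /= ltnn mulr1 opprD addrCA subrr addr0 normrN.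
        by apply: le_lt_trans sw _; rewrite distrC (lt_trans _ de).
      rewrite mulr0 add0r; case: ifP => _; last by rewrite subrr normr0.
      exact: lt_trans (xy i) de.
    by split; [have [] := hC1 (Ordinal kn) _ Uz|exact: zM].
  have := zx n (leqnn n).
  by rewrite (_ : z n = y)//; apply/rowP => j; rewrite mxE ltn_ord.
apply/(cvgrPdist_lt (F := nbhs x)) => eps eps0.
(* The factor [n.+1] instead of [n] makes the final inequality strict and covers n = 0. *)
pose d := Num.min (e / 2) (eps / (M * n.+1%:R)).
have d0 : 0 < d by rewrite lt_min !divr_gt0// mulr_gt0.
have de : d < e by rewrite gt_min ltr_pdivrMr// ltr_pMr// ltr1n.
apply/nbhs_rVP; exists d => // y xy.
rewrite distrC (le_lt_trans (bound d d0 de y xy))//.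
have : d <= eps / (M * n.+1%:R) by rewrite ge_min lexx orbT.
rewrite ler_pdivlMr ?mulr_gt0// => H; apply: lt_le_trans H.
by rewrite -mulr_natr [M * d]mulrC -mulrA !ltr_pM2l// ltr_nat.
Unshelve. all: by end_near. Qed.

(** A Lebesgue number argument: halving the local radius keeps both [x'] and [y] within [r] of the
    centre. It gives uniform continuity as well as a positive distance from a compact set to the
    complement of an open one. *)
Lemma compact_uniform (K : set 'rV[R]_n) (Q : 'rV[R]_n -> 'rV[R]_n -> Prop) :
  compact K ->
  (forall x, K x -> exists2 r : R, 0 < r & forall x' y,
    (forall i, `|x ord0 i - x' ord0 i| < r) ->
    (forall i, `|x ord0 i - y ord0 i| < r) -> Q x' y) ->
  \forall d \near (0 : R)^'+, forall x y, K x ->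
    (forall i, `|x ord0 i - y ord0 i| < d) -> Q x y.
Proof.
move=> cK HQ.
have /compact_near_coveringP/(_ R (0^'+) (fun d x => forall y,
    (forall i, `|x ord0 i - y ord0 i| < d) -> Q x y)) := cK.
have H : forall x : 'rV[R]_n, K x -> \forall x' \near x & d \near 0^'+, forall y,
    (forall i, `|(x' : 'rV[R]_n) ord0 i - y ord0 i| < d) -> Q x' y.
  move=> x /HQ[r r0 xr].
  exists ([set y : 'rV[R]_n | forall i, `|x ord0 i - y ord0 i| < r / 2],
      [set d : R | 0 < d < r / 2]) => /=.
    split.
      by apply/nbhs_rVP; exists (r / 2); rewrite ?divr_gt0.
    by near=> d; apply/andP; split => //; near: d; apply: nbhs_right_lt; rewrite divr_gt0.
  move=> [x' d] /= [xx' /andP[d0 dr]] y x'y; apply: xr => i.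
    apply: lt_le_trans (xx' i) _.
    by rewrite ler_pdivrMr// ler_pMr// ler1n.
  rewrite (splitr r) -(subrKA (x' ord0 i)).
  by rewrite (le_lt_trans (ler_normD _ _))// ltrD// (lt_trans (x'y i)).
move=> /(_ _ H); apply: filterS => d Kd x y Kx; exact: Kd.
Unshelve. all: by end_near. Qed.

Lemma unif_continuous_compact_support (K : set 'rV[R]_n) h :
  compact K -> continuous h -> (forall x, ~ K x -> h x = 0) ->
  forall e : R, 0 < e -> \forall d \near (0 : R)^'+,
    forall x y, (forall i, `|x ord0 i - y ord0 i| < d) -> `|h x - h y| < e.
Proof.
move=> cK ch h0 e e0.
have : \forall d \near (0 : R)^'+, forall x y, K x ->
    (forall i, `|x ord0 i - y ord0 i| < d) -> `|h x - h y| < e.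
  apply: compact_uniform => // x _.
  have /(cvgrPdist_lt (F := nbhs x))/(_ _ (divr_gt0 e0 (ltr0Sn _ 1))) := ch x.
  move=> /nbhs_rVP[r r0 xr]; exists r => // x' y xx' xy.
  rewrite -(subrKA (h x)) (splitr e) (le_lt_trans (ler_normD _ _))// ltrD//.
    by rewrite distrC; exact: xr.
  exact: xr.
apply: filterS => d Kd x y xy.
have [Kx|nKx] := pselect (K x); first exact: Kd xy.
have [Ky|nKy] := pselect (K y); last by rewrite !h0// subrr normr0.
by rewrite distrC; apply: (Kd _ _ Ky) => i; rewrite distrC.
Qed.

End Lines.

(** * Locality of derivatives and extension by zero *)

Section Extension.
Context {R : realType} {n : nat}.
Implicit Types (x y : 'rV[R]_n) (W K : set 'rV[R]_n).

Lemma ext0_in (V : zmodType) W (h : 'rV[R]_n -> V) x : W x -> ext0 W h x = h x.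
Proof. by move=> Wx; rewrite /ext0 patchT// inE. Qed.

Lemma ext0_out (V : zmodType) W (h : 'rV[R]_n -> V) x : ~ W x -> ext0 W h x = 0.
Proof. by move=> Wx; rewrite /ext0 patchC// inE. Qed.

Lemma near_ext0 (V : zmodType) W (h : 'rV[R]_n -> V) x :
  open W -> W x -> \forall y \near x, h y = ext0 W h y.
Proof.
move=> oW Wx; have : nbhs x W by exact: open_nbhs_nbhs.
by apply: filterS => y Wy; rewrite ext0_in.
Qed.

Lemma near_eq_continuous (V : topologicalType) (h k : 'rV[R]_n -> V) x :
  (\forall y \near x, h y = k y) -> {for x, continuous h} ->
  {for x, continuous k}.
Proof.
move=> hk ch; have hkx : h x = k x := nbhs_singleton hk.
suff : k @ x --> k x by [].
by rewrite -hkx; exact: (cvg_trans (near_eq_cvg hk) ch).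
Qed.

Lemma near_eq_C1 (V : normedModType R) (h k : 'rV[R]_n -> V) i x :
  (\forall y \near x, h y = k y) ->
  derivable h x (delta_mx ord0 i) /\ {for x, continuous (partial h i)} ->
  derivable k x (delta_mx ord0 i) /\ {for x, continuous (partial k i)}.
Proof.
move=> hk [dh ch]; split; first exact: near_eq_derivable dh.
apply: near_eq_continuous ch.
apply: filterS (nbhs_interior hk) => y hky.
exact: near_eq_derive.
Qed.

Lemma continuous_rVP (x : 'rV[R]_n) m (F : 'rV[R]_n -> 'rV[R]_m) :
  (forall j, {for x, continuous (fun y => F y ord0 j)}) -> {for x, continuous F}.
Proof.
move=> cF; apply/(cvgrPdist_lt (F := nbhs x)) => e e0; near=> y.
apply: norm_lt_coord => // j; rewrite !mxE; move: j.
near: y; apply: filter_forall => j.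
by have /(cvgrPdist_lt (F := nbhs x)) := cF j; exact.
Unshelve. all: by end_near. Qed.

Lemma partial_coord (phi : 'rV[R]_n -> 'rV[R]_n) i j x :
  derivable phi x (delta_mx ord0 i) ->
  partial (fun y => phi y ord0 j) i x = partial phi i x ord0 j.
Proof. by move=> d; rewrite /partial derive_mx// mxE. Qed.

Lemma C1_coord W (phi : 'rV[R]_n -> 'rV[R]_n) j :
  open W -> C1 W phi -> C1 W (fun x => phi x ord0 j).
Proof.
move=> oW phiC1 i x Wx; have [d c] := phiC1 i x Wx.
split; first by move/derivable_mxP : d; exact.
apply: (@near_eq_continuous _ (fun y => partial phi i y ord0 j)).
  have : nbhs x W by exact: open_nbhs_nbhs.
  apply: filterS => y Wy; have [dy _] := phiC1 i y Wy.
  exact: esym (partial_coord j dy).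
exact: (@continuous_comp _ _ _ (partial phi i) (fun z : 'rV[R]_n => z ord0 j) x c
  (@continuous_coord _ _ j _)).
Qed.

Lemma C1_rV W (phi : 'rV[R]_n -> 'rV[R]_n) :
  open W -> (forall j, C1 W (fun x => phi x ord0 j)) -> C1 W phi.
Proof.
move=> oW phiC1 i x Wx.
have d y : W y -> derivable phi y (delta_mx ord0 i).
  move=> Wy; apply/derivable_mxP => k j; rewrite (ord1 k).
  by have [] := phiC1 j i y Wy.
split; first exact: d.
apply: continuous_rVP => j.
apply: (@near_eq_continuous _ (partial (fun y => phi y ord0 j) i)).
  have : nbhs x W by exact: open_nbhs_nbhs.
  apply: filterS => y Wy; exact: (partial_coord j (d y Wy)).
by have [] := phiC1 j i x Wx.
Qed.

Lemma partialM (a b : 'rV[R]_n -> R) i x :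
  derivable a x (delta_mx ord0 i) -> derivable b x (delta_mx ord0 i) ->
  partial (fun y => a y * b y) i x = a x * partial b i x + b x * partial a i x.
Proof. by move=> da db; rewrite /partial deriveM. Qed.

Lemma C1M W (a b : 'rV[R]_n -> R) :
  open W -> C1 W a -> C1 W b -> C1 W (fun x => a x * b x).
Proof.
move=> oW aC1 bC1 i x Wx.
have [da ca] := aC1 i x Wx; have [db cb] := bC1 i x Wx.
split; first exact: derivableM.
apply: (@near_eq_continuous _
    (fun y => a y * partial b i y + b y * partial a i y)).
  have : nbhs x W by exact: open_nbhs_nbhs.
  apply: filterS => y Wy; have [day _] := aC1 i y Wy; have [dby _] := bC1 i y Wy.
  exact: esym (partialM day dby).
apply: (@continuousD _ R^o); apply: (@continuousM R) => //;
  exact: (C1_continuous oW).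
Qed.

Section CompactSupport.
Variables (W K : set 'rV[R]_n) (h : 'rV[R]_n -> R).
Hypotheses (oW : open W) (cK : closed K) (KW : K `<=` W).
Hypothesis h0 : forall x, W x -> ~ K x -> h x = 0.

Lemma near_ext0_out x : ~ W x -> \forall y \near x, 0 = ext0 W h y.
Proof.
move=> nWx; have : nbhs x (~` K).
  by apply: open_nbhs_nbhs; split; [exact: closed_openC|move=> /KW].
apply: filterS => y nKy; have [Wy|nWy] := pselect (W y).
  by rewrite ext0_in// h0.
by rewrite ext0_out.
Qed.

Lemma continuous_ext0 : (forall x, W x -> {for x, continuous h}) ->
  continuous (ext0 W h).
Proof.
move=> ch x; have [Wx|nWx] := pselect (W x).
  by apply: near_eq_continuous (ch x Wx); exact: near_ext0.
apply: (@near_eq_continuous _ (cst 0) _ _ (near_ext0_out nWx)).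
exact: (@cst_continuous _ _ (0 : R) x).
Qed.

Lemma partial_ext0 i : partial (ext0 W h) i = ext0 W (partial h i).
Proof.
apply/funext => x; have [Wx|nWx] := pselect (W x).
  rewrite ext0_in//; apply/esym/near_eq_derive.
  exact: near_ext0.
rewrite (ext0_out _ nWx) -(derive_cst (0 : R) x (delta_mx ord0 i)).
by apply/esym/near_eq_derive; exact: near_ext0_out.
Qed.

Lemma partial_out i x : W x -> ~ K x -> partial h i x = 0.
Proof.
move=> Wx nKx; rewrite -(derive_cst (0 : R) x (delta_mx ord0 i)).
apply/esym/near_eq_derive.
have : nbhs x (W `&` ~` K).
  apply: open_nbhs_nbhs; split => //; apply: openI => //.
  exact: closed_openC.
by apply: filterS => y [Wy nKy]; rewrite h0.
Qed.

Lemma C1_ext0 : C1 W h -> C1 setT (ext0 W h).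
Proof.
move=> hC1 i x _; have [Wx|nWx] := pselect (W x).
  by apply: near_eq_C1 (hC1 i x Wx); exact: near_ext0.
apply: (@near_eq_C1 _ (cst 0)); first exact: near_ext0_out.
split; first exact: derivable_cst.
rewrite (_ : partial _ _ = cst 0); first exact: (@cst_continuous _ _ (0 : R) x).
by apply/funext => y; rewrite /partial derive_cst.
Qed.

End CompactSupport.

End Extension.

(** * Riemann sums over product partitions *)

Section Integrals.
Context d (T : measurableType d) (R : realType) (mu : {measure set T -> \bar R}).

Lemma bounded_integrable (D : set T) (h : T -> R) (M : R) : measurable D ->
  (mu D < +oo)%E -> measurable_fun D h -> (forall x, D x -> `|h x| <= M) ->
  mu.-integrable D (EFin \o h).
Proof.
move=> mD Doo mh hM; apply: measurable_bounded_integrable => //.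
exists M; split; first exact: num_real.
by move=> M' MM' x Dx; exact: le_trans (hM x Dx) (ltW MM').
Qed.

Lemma Rintegral_sum (I : Type) (r : seq I) (D : set T) (h : I -> T -> R) :
  measurable D -> (forall i, mu.-integrable D (EFin \o h i)) ->
  (mu.-integrable D (EFin \o (fun x => \sum_(i <- r) h i x))) /\
  \int[mu]_(x in D) (\sum_(i <- r) h i x) = \sum_(i <- r) \int[mu]_(x in D) h i x.
Proof.
move=> mD ih; elim: r => [|i r [IH1 IH2]].
  rewrite big_nil; split.
    apply: (eq_integrable mD (cst 0%E)); last exact: integrable0.
    by move=> x _ /=; rewrite big_nil.
  rewrite (_ : (fun=> _) = (fun=> 0)) ?Rintegral_cst ?mul0r//.
  by apply/funext => x; rewrite big_nil.
rewrite big_cons -IH2 -RintegralD//.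
have E : (fun x => \sum_(i0 <- i :: r) h i0 x) =
    (fun x => h i x + \sum_(i <- r) h i x).
  by apply/funext => x; rewrite big_cons.
rewrite E; split => //.
by apply: (eq_integrable mD _ _ _ (integrableD mD (ih i) IH1)).
Qed.

End Integrals.

(** * Cubes of a product partition *)

Section Cubes.
Context {R : realType} {n : nat}.
Variables (a b : 'rV[R]_n) (s : 'I_n -> seq R).
Hypothesis part : is_partition a b s.
Implicit Types (x y : 'rV[R]_n) (j : cube s) (i : 'I_n).

Local Notation node := (node a b s).
Local Notation width := (@width R n a b s).
Local Notation vertex := (@vertex R n a b s).

Lemma node0 i : node i 0 = a ord0 i.
Proof. by []. Qed.

Lemma node_size i : node i (size (s i)) = b ord0 i.
Proof.
have [_ /eqP <-] := part i.
by rewrite /Defs.node -[size _]/(size (a ord0 i :: s i)).-1 nth_last.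
Qed.

Lemma node_lt i k l : (k < l)%N -> (l <= size (s i))%N -> node i k < node i l.
Proof.
move=> kl ls; have [ps _] := part i.
apply: (sorted_ltn_nth lt_trans _ (s := a ord0 i :: s i)) => //.
by rewrite inE /= ltnS (leq_trans (ltnW kl)).
Qed.

Lemma node_le i k l : (k <= l)%N -> (l <= size (s i))%N -> node i k <= node i l.
Proof.
rewrite leq_eqVlt => /orP[/eqP -> //|kl ls]; exact/ltW/node_lt.
Qed.

Lemma node_find i (t : R) : a ord0 i <= t < b ord0 i ->
  exists k : 'I_(size (s i)), node i k <= t < node i k.+1.
Proof.
rewrite -node0 -node_size => /andP[].
have : (size (s i) <= size (s i))%N by [].
(* The induction shrinks the right end [m] of the searched range, while the index type keeps the
   full size. *)
move: {1 3}(size (s i)) => m; elim: m => [_|m IH ms h0 hm].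
  by move=> h1 h2; have := le_lt_trans h1 h2; rewrite ltxx.
have [tm|mt] := ltP t (node i m); first exact: IH (ltnW ms) h0 tm.
by exists (Ordinal ms); rewrite mt.
Qed.

Lemma width_gt0 j i : 0 < width j i.
Proof. by rewrite subr_gt0; apply: node_lt. Qed.

(** Half-open, so that the cubes partition [hcell a b] exactly and no common faces have to be
    discarded. *)
Definition hcube j : set 'rV[R]_n :=
  box (fun i => `[node i (j i), node i (j i).+1[%classic).

Definition ccube j : set 'rV[R]_n :=
  [set x | forall i, node i (j i) <= x ord0 i <= node i (j i).+1].

Definition hcell (u v : 'rV[R]_n) : set 'rV[R]_n :=
  box (fun i => `[u ord0 i, v ord0 i[%classic).

Lemma hcube_ccube j : hcube j `<=` ccube j.
Proof.
by move=> x xj i; have := xj i; rewrite /= in_itv/= => /andP[-> /ltW ->].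
Qed.

Lemma hcube_inj j j' x : hcube j x -> hcube j' x -> j = j'.
Proof.
have H k k' i : hcube k x -> hcube k' x -> (k' i <= k i)%N.
  move=> /(_ i) + /(_ i); rewrite /= !in_itv/= => /andP[h1 h2] /andP[h3 h4].
  rewrite leqNgt; apply/negP => kk'; have := @node_le i (k i).+1 (k' i) kk'.
  by move=> /(_ (ltnW (ltn_ord _))); lra.
move=> xj xj'; apply/ffunP => i; apply/val_inj/anti_leq.
by apply/andP; split; exact: H.
Qed.

Lemma hcube_cover x : hcell a b x -> exists j, hcube j x.
Proof.
move=> xab.
have H i : {k : 'I_(size (s i)) | node i k <= x ord0 i < node i k.+1}.
  by apply: cid; apply: node_find; have := xab i; rewrite /= in_itv.
exists (finfun (fun i => sval (H i)) : cube s) => i.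
by rewrite /= in_itv/= ffunE; case: (H i).
Qed.

Lemma hcube_hcell j : hcube j `<=` hcell a b.
Proof.
move=> x xj i; have := xj i; rewrite /= !in_itv/= => /andP[h1 h2].
rewrite (le_trans _ h1) -?node0 ?node_le//=; last exact: ltnW.
by rewrite (lt_le_trans h2)// -node_size node_le.
Qed.

Lemma measurable_hcube j : measurable (hcube j).
Proof. by apply: measurable_box => i; exact: measurable_itv. Qed.

Lemma measurable_hcell u v : measurable (hcell u v).
Proof. by apply: measurable_box => i; exact: measurable_itv. Qed.

Lemma lebesgue_itvco (u v : R) : u <= v ->
  lebesgue_measure `[u, v[%classic = (v - u)%:E.
Proof.
rewrite lebesgue_measure_itv/= lte_fin => uv; case: ltP => //.
move=> vu; have -> : u = v by apply/le_anti; rewrite uv vu.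
by rewrite subrr.
Qed.

Lemma lebesgue_hcube j : lebesgue_rV R n (hcube j) = (\prod_i width j i)%:E.
Proof.
apply: lebesgue_rV_box => i; first exact: measurable_itv.
by rewrite lebesgue_itvco// node_le.
Qed.

Lemma lebesgue_hcell (u v : 'rV[R]_n) : (forall i, u ord0 i <= v ord0 i) ->
  lebesgue_rV R n (hcell u v) = (\prod_i (v ord0 i - u ord0 i))%:E.
Proof.
move=> uv; apply: lebesgue_rV_box => i; first exact: measurable_itv.
exact: lebesgue_itvco.
Qed.

Lemma partition_le i : a ord0 i <= b ord0 i.
Proof. by rewrite -node_size -node0 node_le. Qed.

(** The numbers [t j] need not be values of [psi]: difference quotients are put in their place, both
    for the discrete sums and for the telescoping ones. *)
Lemma Riemann_sum_error (t : cube s -> R) (psi : 'rV[R]_n -> R) (eps M : R) :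
  measurable_fun (hcell a b) psi ->
  (forall x, hcell a b x -> `|psi x| <= M) ->
  (forall j x, hcube j x -> `|t j - psi x| <= eps) ->
  `|\sum_j t j * \prod_i width j i - \int[lebesgue_rV R n]_(x in hcell a b) psi x|
    <= eps * \prod_i (b ord0 i - a ord0 i).
Proof.
move=> mpsi psiM tpsi; set mu := lebesgue_rV R n; set B := hcell a b.
have mB : measurable B := measurable_hcell a b.
have muB : mu B = (\prod_i (b ord0 i - a ord0 i))%:E.
  by apply: lebesgue_hcell => i; exact: partition_le.
have Boo : (mu B < +oo)%E by rewrite muB ltry.
(* The sum is the integral of the step function equal to t j on hcube j. *)
pose ind j x : R := t j * \1_(hcube j) x.
have iind j : mu.-integrable B (EFin \o ind j).
  apply: (@bounded_integrable _ _ _ _ _ _ `|t j|) => //.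
    apply: measurable_funM => //.
    exact: measurable_indic (measurable_hcube _).
  move=> x _; rewrite /ind normrM ler_piMr// indicE.
  by case: (_ \in _); rewrite ?normr1 ?normr0.
have [iS ES] := Rintegral_sum (index_enum (cube s)) mB iind.
have E j : \int[mu]_(x in B) ind j x = t j * \prod_i width j i.
  rewrite RintegralZl//; last first.
    apply: (@bounded_integrable _ _ _ _ _ _ 1) => //.
      exact: measurable_indic (measurable_hcube _).
    by move=> x _; rewrite indicE; case: (_ \in _); rewrite ?normr1 ?normr0.
  congr (_ * _); rewrite /Rintegral integral_indic//; last exact: measurable_hcube.
  rewrite setIidl; last exact: hcube_hcell.
  exact: (congr1 fine (lebesgue_hcube j)).
rewrite -(eq_bigr _ (fun j _ => E j)) -ES.
have ipsi : mu.-integrable B (EFin \o psi) by exact: (bounded_integrable mB Boo mpsi psiM).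
rewrite -RintegralB//.
have iD : mu.-integrable B (EFin \o (fun x => \sum_j ind j x - psi x)).
  by apply: (eq_integrable mB _ _ _ (integrableB mB iS ipsi)).
apply: le_trans (le_normr_Rintegral mB iD) _.
have -> : \prod_i (b ord0 i - a ord0 i) = fine (mu B) by rewrite muB.
rewrite -Rintegral_cst//; apply: le_Rintegral => //.
- exact: (integrable_norm iD).
- by apply: (@bounded_integrable _ _ _ _ _ _ `|eps|).
- move=> x Bx; have [j xj] := hcube_cover Bx.
  rewrite (bigD1 j)//= big1 => [|j' jj'].
    by rewrite addr0 /ind indicE mem_set// mulr1; exact: tpsi.
  rewrite /ind indicE memNset ?mulr0// => xj'.
  by move/eqP: jj'; apply; exact: hcube_inj xj' xj.
Qed.

Lemma ccube_dist j x y i : ccube j x -> ccube j y ->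
  `|x ord0 i - y ord0 i| <= width j i.
Proof.
move=> /(_ i)/andP[x1 x2] /(_ i)/andP[y1 y2].
by rewrite ler_distl /Defs.width; apply/andP; split; lra.
Qed.

Lemma vertex_ccube j e : ccube j (vertex j e).
Proof.
move=> i; rewrite mxE; case: (i \in e); rewrite ?addn1 ?addn0 lexx ?andbT/=.
  exact: node_le.
exact: node_le.
Qed.

Lemma coord_le_enorm (x : 'rV[R]_n) i : `|x ord0 i| <= enorm x.
Proof.
rewrite -sqrtr_sqr ler_wsqrtr// (bigD1 i)//= lerDl.
by apply: sumr_ge0 => k _; exact: sqr_ge0.
Qed.

Lemma width_le_mesh j i : width j i <= mesh a b s.
Proof.
rewrite /mesh; apply: le_trans (le_bigmax _ _ j) => /=.
apply: le_trans (le_bigmax _ _ [set i]%SET) => /=.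
apply: le_trans (le_bigmax _ _ finset.set0) => /=.
apply: le_trans (coord_le_enorm _ i).
rewrite !mxE inE eqxx inE addn1 addn0; exact: ler_norm.
Qed.

Lemma vertexD1 j (e : {set 'I_n}) i : i \in e ->
  vertex j e = width j i *: delta_mx ord0 i + vertex j (e :\ i)%SET.
Proof.
move=> ie; apply/rowP => k; rewrite delta_lineE !mxE !inE.
have [->|ki] := eqVneq k i; last by rewrite mulr0 add0r.
by rewrite ie addn1 addn0 mulr1 subrK.
Qed.

(** Removing [i] matches the subsets that contain it with those that do not, so each kind is half of
    all subsets. This is the normalisation in [dif]. *)
Lemma card_containing i : #|[set e : {set 'I_n} | i \in e]%SET| = (2 ^ n.-1)%N.
Proof.
have E : [set e : {set 'I_n} | i \notin e]%SET =
    [set (e :\ i)%SET | e : {set 'I_n} in [set e : {set 'I_n} | i \in e]%SET]%SET.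
  apply/setP => e; rewrite inE; apply/idP/imsetP => [ie|[e' _ ->]].
    exists (i |: e)%SET; first by rewrite inE setU11.
    by rewrite setU1K.
  by rewrite setD11.
have n0 : (0 < n)%N by exact: leq_ltn_trans (leq0n i) (ltn_ord i).
have := cardsC [set e : {set 'I_n} | i \in e]%SET.
rewrite (_ : (~: _)%SET = [set e : {set 'I_n} | i \notin e]%SET); last first.
  by apply/setP => e; rewrite !inE.
rewrite E card_in_imset; last first.
  move=> e e'; rewrite !inE => ie ie' ee'.
  by rewrite -(finset.setD1K ie) ee' finset.setD1K.
rewrite -[#|{set 'I_n}|]cardsT -powersetT card_powerset cardsT card_ord addnn -mul2n.
have -> : (2 ^ n = 2 * 2 ^ n.-1)%N by rewrite -expnS prednK.
by move/eqP; rewrite eqn_mul2l => /eqP.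
Qed.

(** Along each of the 2^(n-1) edges in direction [i] the increment is the width times a value of the
    partial derivative on the cube; averaging over the edges preserves the bound. In the application
    [c] is the field at the tag and [z] the integrand at some point of the cube. *)
Lemma dif_approx (F : 'rV[R]_n -> R) i j (c z eps : R) :
  (forall x, ccube j x -> derivable F x (delta_mx ord0 i) /\
     `|partial F i x * c - z| <= eps) ->
  `|dif a b F i j * c - z * width j i| <= eps * width j i.
Proof.
move=> HF; set w := width j i; have w0 : 0 < w := width_gt0 j i.
have He (e : {set 'I_n}) : i \in e ->
    `|(F (vertex j e) - F (vertex j (e :\ i)%SET)) * c - z * w| <= eps * w.
  move=> ie; rewrite (vertexD1 j ie) -/w.
  have line t : 0 <= t <= w -> ccube j (t *: delta_mx ord0 i + vertex j (e :\ i)%SET).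
    move=> /andP[t0 tw] k; rewrite delta_lineE.
    have := vertex_ccube j (e :\ i)%SET k; have [->|ki] := eqVneq k i.
      by rewrite !mxE setD11 addn0 mulr1 lexx lerDr t0/= -lerBrDr.
    by rewrite mulr0 add0r.
  have [|t tw ->] := @MVT_line _ _ F (vertex j (e :\ i)%SET) i w (ltW w0).
    by move=> t /line/HF[].
  have [_ H] := HF _ (line _ tw).
  by rewrite mulrAC -mulrBl normrM (gtr0_norm w0) ler_wpM2r// ltW.
pose N : R := 2 ^+ n.-1; have N0 : 0 < N by rewrite exprn_gt0.
have NE (y : R) : \sum_(e : {set 'I_n} | i \in e) y = y * N.
  rewrite sumr_const -mulr_natr; congr (_ * _); rewrite /N -natrX; congr _%:R.
  by rewrite -(card_containing i) cardsE.
rewrite -(ler_pM2r N0) -[X in _ <= X]NE -[X in _ * X <= _](gtr0_norm N0) -normrM.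
rewrite mulrBl /dif -/N; set S := \sum_(e : {set _} | _) (_ - _).
have -> : N^-1 * S * c * N = S * c by field; rewrite gt_eqF.
rewrite mulr_suml -NE -sumrB (le_trans (ler_norm_sum _ _ _))//.
exact: ler_sum.
Qed.

End Cubes.

(** * Bounded domains and compactly supported functions *)

Section BoundedDomain.
Context {R : realType} {n : nat}.
Implicit Types (x y : 'rV[R]_n) (W K : set 'rV[R]_n) (h : 'rV[R]_n -> R).

Lemma compact_closure W : bounded_set W -> compact (closure W).
Proof.
move=> /bounded_rVP[M M0 WM].
pose B : set 'rV[R]_n := [set x | forall i, `[- M, M]%classic (x ord0 i)].
have cB : compact B.
  by apply: (@rV_compact _ _ (fun=> `[- M, M]%classic)) => i; exact: segment_compact.
apply: (subclosed_compact _ cB); first exact: closed_closure.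
have clB : closed B := compact_closed (@norm_hausdorff _ _) cB.
rewrite ((closure_id B).1 clB).
apply: closureS => x Wx i.
by rewrite /= in_itv/= -ler_norml ltW// WM.
Qed.

Lemma within_closure_bounded W h : bounded_set W ->
  {within closure W, continuous h} ->
  exists2 M, 0 < M & forall x, W x -> `|h x| <= M.
Proof.
move=> bW ch; have := continuous_compact ch (compact_closure bW).
move=> /compact_bounded/pinfty_ex_gt0[M M0 hM]; exists M => // x Wx.
by apply: hM; exists x => //; exact: subset_closure.
Qed.

Lemma lebesgue_bounded W : bounded_set W -> measurable W ->
  (lebesgue_rV R n W < +oo)%E.
Proof.
move=> /bounded_rVP[M M0 WM] mW.
pose u : 'rV[R]_n := const_mx (- M); pose v : 'rV[R]_n := const_mx M.
apply: (@le_lt_trans _ _ (lebesgue_rV R n (hcell u v))); last first.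
  by rewrite lebesgue_hcell ?ltry// => i; rewrite !mxE lerNl (le_trans _ (ltW M0))// oppr_le0 ltW.
apply: le_measure; rewrite ?inE//; first exact: measurable_hcell.
move=> x Wx i; have := WM x Wx i; rewrite /= in_itv/= !mxE ltr_norml.
by move=> /andP[/ltW -> ->].
Qed.

Lemma compact_support_integrable W K h : open W -> bounded_set W ->
  compact K -> K `<=` W -> (forall x, W x -> ~ K x -> h x = 0) ->
  (forall x, W x -> {for x, continuous h}) ->
  (lebesgue_rV R n).-integrable W (EFin \o h).
Proof.
move=> oW bW cK KW h0 ch; have mW := open_measurable_rV oW.
have cK' : closed K := compact_closed (@norm_hausdorff _ _) cK.
have : {within K, continuous h}.
  by apply: continuous_in_subspaceT => x; rewrite inE => /KW/ch.
move=> /continuous_compact/(_ cK)/compact_bounded/pinfty_ex_gt0[M M0 hM].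
apply: (@bounded_integrable _ _ _ _ _ _ M) => //.
- exact: lebesgue_bounded.
- exact: measurable_fun_continuous.
- move=> x Wx; have [Kx|nKx] := pselect (K x); last by rewrite h0// normr0 ltW.
  by apply: hM; exists x.
Qed.

Lemma compact_support_bounded K h : compact K -> continuous h ->
  (forall x, ~ K x -> h x = 0) -> exists2 M, 0 < M & forall x, `|h x| <= M.
Proof.
move=> cK ch h0; have : {within K, continuous h} by exact: continuous_subspaceT.
move=> /continuous_compact/(_ cK)/compact_bounded/pinfty_ex_gt0[M M0 hM].
exists M => // x; have [Kx|nKx] := pselect (K x); first by apply: hM; exists x.
by rewrite h0// normr0 ltW.
Qed.

Lemma Rintegral_ext0 W B h : measurable W -> measurable B ->
  (forall x, ~ B x -> ext0 W h x = 0) ->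
  \int[lebesgue_rV R n]_(x in W) h x = \int[lebesgue_rV R n]_(x in B) ext0 W h x.
Proof.
move=> mW mB hB; rewrite Rintegral_mkcond [RHS]Rintegral_mkcond.
apply: eq_Rintegral => x _; rewrite [RHS]patchE.
have [Bx|nBx] := pselect (B x); first by rewrite mem_set// /ext0.
by rewrite memNset// -[LHS]/(ext0 W h x) hB.
Qed.

(** The support is known to lie in the closed cell, but the cubes cover only the half-open one. A
    continuous function that is nonzero on an upper face would still be nonzero slightly beyond it,
    outside the closed cell. *)
Lemma zero_off_hcell (a b : 'rV[R]_n) h : continuous h ->
  (forall x, ~ cell a b x -> h x = 0) -> forall x, ~ hcell a b x -> h x = 0.
Proof.
move=> ch h0 x nx; apply/eqP; apply: contraPT (nx) => hx.
have : \forall y \near x, h y != 0.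
  by apply: (cvgr_neq0 (F := nbhs x)) hx => //; exact: ch.
move=> /nbhs_rVP[r r0 xr].
have incell y : h y != 0 -> cell a b y.
  by move=> hy; apply: contrapT => /h0 hy0; rewrite hy0 eqxx in hy.
suff : hcell a b x by [].
move=> i; rewrite /= in_itv/=; have /andP[-> _] := incell x hx i => /=.
have : h ((r / 2) *: delta_mx ord0 i + x) != 0.
  apply: xr => k; rewrite delta_lineE opprD addrCA subrr addr0 normrN.
  case: eqP => _; rewrite ?mulr0 ?normr0// mulr1 gtr0_norm ?divr_gt0//.
  by rewrite ltr_pdivrMr// ltr_pMr// ltr1n.
move=> /incell/(_ i)/andP[_]; rewrite delta_lineE eqxx mulr1; apply: lt_le_trans.
by rewrite ltrDr divr_gt0.
Qed.

End BoundedDomain.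

(** * Uniform grids and integration by parts *)

Section UniformPartition.
Context {R : realType} {n : nat}.
Variables (a b : 'rV[R]_n) (N : nat).
Hypotheses (ab : forall i, a ord0 i < b ord0 i) (N0 : (0 < N)%N).

Definition upart (i : 'I_n) : seq R :=
  mkseq (fun k => a ord0 i + (b ord0 i - a ord0 i) * k.+1%:R / N%:R) N.

Lemma size_upart i : size (upart i) = N.
Proof. exact: size_mkseq. Qed.

Lemma node_upart i k : (k <= N)%N ->
  node a b upart i k = a ord0 i + (b ord0 i - a ord0 i) * k%:R / N%:R.
Proof.
case: k => [|k] kN; first by rewrite /node /= mulr0 mul0r addr0.
by rewrite /node /= nth_mkseq.
Qed.

Lemma upart_partition : is_partition a b upart.
Proof.
move=> i; split.
  apply/(pathP (b ord0 i)) => k; rewrite size_upart => kN.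
  rewrite -[X in (X < _)%O]/(node a b upart i k) -[X in (_ < X)%O]/(node a b upart i k.+1).
  rewrite !node_upart//; last exact: ltnW.
  by rewrite ltrD2l ltr_pM2r ?invr_gt0 ?ltr0n// ltr_pM2l ?subr_gt0// ltr_nat.
apply/eqP; have := node_upart i (leqnn N).
rewrite mulfK ?pnatr_eq0 -?lt0n// subrKC => <-.
by rewrite /node -{1}(size_upart i) -[size _]/(size (a ord0 i :: upart i)).-1 nth_last.
Qed.

Lemma width_upart (j : cube upart) i :
  width a b j i = (b ord0 i - a ord0 i) / N%:R.
Proof.
have jN : (j i < N)%N by rewrite -[X in (_ < X)%N](size_upart i).
rewrite /width !node_upart//; last exact: ltnW.
by rewrite -(natr1 (j i)); field; rewrite pnatr_eq0 -lt0n.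
Qed.

End UniformPartition.

(** The Euclidean diameter of a cube is at most the sum of its widths, here [L / N]. *)
Lemma mesh_upart (R : realType) n (a b : 'rV[R]_n) (delta : R) :
  (forall i, a ord0 i < b ord0 i) -> 0 < delta ->
  exists2 N, (0 < N)%N & mesh a b (upart a b N) < delta.
Proof.
move=> ab d0; pose L := \sum_i (b ord0 i - a ord0 i).
have L0 : 0 <= L by apply: sumr_ge0 => i _; rewrite subr_ge0 ltW.
exists (Num.truncn (L / delta)).+1 => //.
set N := _.+1; have part := upart_partition ab (ltn0Sn _ : (0 < N)%N).
have LN : L / N%:R < delta.
  by rewrite ltr_pdivrMr ?ltr0n// mulrC -ltr_pdivrMr// truncnS_gt.
apply/bigmax_lt => // j _; apply/bigmax_lt => // e _; apply/bigmax_lt => // e' _.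
apply: le_lt_trans LN; rewrite -[leRHS]ger0_norm; last by rewrite divr_ge0.
rewrite -sqrtr_sqr ler_wsqrtr// /L mulr_suml.
have sq (I : Type) (r : seq I) (F G : I -> R) : (forall i, `|F i| <= G i) ->
    \sum_(i <- r) F i ^+ 2 <= (\sum_(i <- r) G i) ^+ 2.
  move=> FG; have G0 i : 0 <= G i by apply: le_trans (FG i).
  elim: r => [|i r IH]; first by rewrite !big_nil expr0n.
  rewrite !big_cons sqrrD -addrA lerD//.
    by rewrite -real_normK ?num_real// lerXn2r ?nnegrE.
  by rewrite (le_trans IH)// lerDr mulrn_wge0// mulr_ge0// sumr_ge0.
apply: sq => i; rewrite !mxE.
rewrite -(width_upart (ltn0Sn _ : (0 < N)%N) j).
have := @ccube_dist _ _ a b _ j _ _ i (vertex_ccube part j e) (vertex_ccube part j e').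
by rewrite !mxE.
Qed.

Section Telescope.
Context {R : realType} {n : nat}.
Implicit Types (x y : 'rV[R]_n).

Lemma near0_gt0 (P : R -> Prop) : (\forall d \near (0 : R)^'+, P d) ->
  exists2 d, 0 < d & P d.
Proof. by move=> HP; near (0 : R)^'+ => d; exists d => //; near: d. Unshelve. all: by end_near. Qed.

Lemma Rintegral_partial (K : set 'rV[R]_n) (F : 'rV[R]_n -> R) (M : R) i :
  compact K -> 0 < M -> (forall x, K x -> forall k, `|x ord0 k| < M) ->
  C1 setT F -> (forall x, ~ K x -> F x = 0) ->
  \int[lebesgue_rV R n]_(x in hcell (const_mx (- M)) (const_mx M)) partial F i x = 0.
Proof.
move=> cK M0 KM FC1 F0.
pose a : 'rV[R]_n := const_mx (- M); pose b : 'rV[R]_n := const_mx M.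
rewrite -/a -/b.
have ab k : a ord0 k < b ord0 k by rewrite !mxE gtrN.
have cK' : closed K := compact_closed (@norm_hausdorff _ _) cK.
have cpsi : continuous (partial F i) by move=> x; have [] := FC1 i x.
have psi0 x : ~ K x -> partial F i x = 0.
  by move=> nKx; apply: (@partial_out _ _ setT K) => //; [exact: openT|move=> y _; exact: F0].
have dF x : derivable F x (delta_mx ord0 i) by have [] := FC1 i x.
have [B B0 psiB] := compact_support_bounded cK cpsi psi0.
set I := \int[_]_(x in _) _.
pose V := \prod_i (b ord0 i - a ord0 i).
have V0 : 0 < V by apply: prodr_gt0 => k _; rewrite subr_gt0.
(* The integral is shown to be at most every e > 0 in absolute value. *)
apply/eqP; rewrite -normr_eq0; apply/eqP/le_anti; rewrite normr_ge0 andbT.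
apply/ler_addgt0Pl => e e0; rewrite addr0.
have eV0 : 0 < e / V by rewrite divr_gt0.
have [d d0 Hd] := near0_gt0 (unif_continuous_compact_support cK cpsi psi0 eV0).
have [N N0 meshN] := mesh_upart ab d0.
set s := upart a b N in meshN.
have part : is_partition a b s := upart_partition ab N0.
pose w : R := (M + M) / N%:R.
have widthE (j : cube s) k : width a b j k = w.
  by rewrite width_upart// !mxE opprK.
have w0 : 0 < w by rewrite divr_gt0 ?addr_gt0// ltr0n.
pose v (j : cube s) := vertex a b j finset.set0.
(* The mean slope of [F] along the edge in direction [i] from the lowest vertex, which is a value of
   the partial derivative in the closed cube. *)
pose t (j : cube s) := (F (w *: delta_mx ord0 i + v j) - F (v j)) / w.
have line (j : cube s) u : 0 <= u <= w -> ccube a b j (u *: delta_mx ord0 i + v j).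
  move=> /andP[u0 uw] k; rewrite delta_lineE.
  have := vertex_ccube part j finset.set0 k; have [->|ki] := eqVneq k i.
    rewrite !mxE inE addn0 mulr1 lexx lerDr u0/= -lerBrDr.
    by rewrite -[X in _ -> _ <= X]/(width a b j i) widthE.
  by rewrite mulr0 add0r.
have tpsi (j : cube s) x : hcube a b j x -> `|t j - partial F i x| <= e / V.
  move=> /hcube_ccube xj; have [|u uw] := @MVT_line _ _ F (v j) i w (ltW w0).
    by move=> u _; exact: dF.
  rewrite /t => ->; rewrite mulfK ?gt_eqF//; apply/ltW/Hd => k.
  apply: le_lt_trans (ccube_dist k (line j _ uw) xj) _.
  by apply: le_lt_trans meshN; exact: width_le_mesh.
have mpsi : measurable_fun (hcell a b) (partial F i).
  apply: measurable_funS (measurable_fun_continuous openT (fun x _ => cpsi x)) => //.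
have := Riemann_sum_error part mpsi (fun x _ => psiB x) tpsi.
rewrite -/V -/I divfK ?gt_eqF//.
suff -> : \sum_j t j * \prod_k width a b j k = 0 by rewrite sub0r normrN.
(* F vanishes on the boundary of the cell, so summing over the cyclic shift of
   the i-th index gives the same sum. *)
pose sh (j : cube s) : cube s := [ffun k => if k == i then ordS (j k) else j k].
have sh_inj : injective sh.
  move=> j j' /ffunP jj'; apply/ffunP => k; have := jj' k; rewrite !ffunE.
  by case: eqP => // _ /ordS_inj.
have shF (j : cube s) : F (w *: delta_mx ord0 i + v j) = F (v (sh j)).
  have := ltn_ord (j i); rewrite leq_eqVlt => /orP[/eqP jN|jN].
    rewrite !F0//.
      move=> /KM/(_ i); rewrite mxE ffunE eqxx inE addn0 /= jN modnn node0 mxE.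
      by rewrite normrN gtr0_norm// ltxx.
    move=> /KM/(_ i); rewrite delta_lineE eqxx mulr1 -(widthE j i) /width mxE inE addn0 subrK.
    by rewrite jN node_size// mxE gtr0_norm// ltxx.
  congr F; apply/rowP => k; rewrite delta_lineE !mxE !inE !addn0 ffunE.
  have [->|ki] := eqVneq k i; last by rewrite mulr0 add0r.
  by rewrite mulr1 /= modn_small// -(widthE j i) /width subrK.
rewrite (eq_bigr (fun j => (F (v (sh j)) - F (v j)) * (w^-1 * w ^+ n))); last first.
  move=> j _; rewrite /t shF -mulrA; congr (_ * (_ * _)).
  by rewrite (eq_bigr (fun=> w)) ?prodr_const ?card_ord// => k _.
rewrite -mulr_suml sumrB [X in _ - X](reindex_inj sh_inj) subrr mul0r//.
Qed.

End Telescope.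

(** * The discrete and the divergence functionals *)

Section Field.
Context {R : realType} {n : nat}.
Implicit Types (x y : 'rV[R]_n) (g : 'rV[R]_n -> R) (phi : 'rV[R]_n -> 'rV[R]_n).

Definition gdot g phi x : R := \sum_i partial g i x * phi x ord0 i.

Lemma continuous_at_sum (I : Type) (r : seq I) (h : I -> 'rV[R]_n -> R) x :
  (forall i, {for x, continuous (h i)}) ->
  {for x, continuous (fun y => \sum_(i <- r) h i y)}.
Proof.
move=> ch; elim: r => [|i r IH].
  rewrite (_ : (fun _ => _) = cst 0); first exact: (@cst_continuous _ _ (0 : R) x).
  by apply/funext => y; rewrite big_nil.
rewrite (_ : (fun _ => _) = (fun y => h i y + \sum_(j <- r) h j y)).
  exact: (@continuousD _ R^o _ _ _ _ (ch i) IH).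
by apply/funext => y; rewrite big_cons.
Qed.

Section DualPairing.
Variables (Omega : set 'rV[R]_n) (g : 'rV[R]_n -> R).
Hypotheses (oO : open Omega) (bO : bounded_set Omega) (gC1 : C1_closure Omega g).

Let gO : C1 Omega g. Proof. by case: gC1. Qed.

(** The derivatives extend continuously to the closure, which is compact because [Omega] is
    bounded. *)
Lemma C1_closure_bounded : exists2 M, 0 < M &
  forall x, Omega x -> forall i, `|partial g i x| <= M.
Proof.
case: gC1 => _ _ Gi.
have H i : {M | 0 < M & forall x, Omega x -> `|partial g i x| <= M}.
  apply: cid2; have [G cG GE] := Gi i.
  have [M M0 GM] := within_closure_bounded bO cG.
  by exists M => // x Ox; rewrite -GE//; exact: GM.
pose m i := s2val (H i); have m0 i : 0 < m i by exact: (s2valP (H i)).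
exists (1 + \sum_i m i); first by rewrite ltr_pwDl// sumr_ge0// => i _; exact: ltW.
move=> x Ox i; rewrite (bigD1 i)//= addrCA ler_wpDr//.
  by rewrite addr_ge0// sumr_ge0// => k _; exact: ltW.
exact: (s2valP' (H i)).
Qed.

Section OneField.
Variable phi : 'rV[R]_n -> 'rV[R]_n.
Hypothesis phiC1 : C1c Omega phi.
Let K := supp Omega phi.

Let cK : compact K. Proof. by case: phiC1. Qed.
Let clK : closed K. Proof. exact: closed_closure. Qed.
Let KO : K `<=` Omega. Proof. by case: phiC1. Qed.

Lemma supp0 x : Omega x -> ~ K x -> phi x = 0.
Proof.
move=> Ox nKx; apply/eqP; apply: contrapT => /negP phix; apply: nKx.
by apply: subset_closure; split.
Qed.

Let phi0 i x : Omega x -> ~ K x -> phi x ord0 i = 0.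
Proof. by move=> Ox /(supp0 Ox) ->; rewrite mxE. Qed.

Let phi_i_C1 i : C1 Omega (fun x => phi x ord0 i).
Proof. by apply: C1_coord => //; case: phiC1. Qed.

Let Phi i := ext0 Omega (fun x => phi x ord0 i).

Let ext0_phi x i : ext0 Omega phi x ord0 i = Phi i x.
Proof.
have [Ox|nOx] := pselect (Omega x); first by rewrite /Phi !ext0_in.
by rewrite /Phi !ext0_out// mxE.
Qed.

Let off (h : 'rV[R]_n -> R) : (forall x, Omega x -> ~ K x -> h x = 0) ->
  forall x, ~ K x -> ext0 Omega h x = 0.
Proof.
move=> h0 x nKx; have [Ox|nOx] := pselect (Omega x); last by rewrite ext0_out.
by rewrite ext0_in// h0.
Qed.

Let cphi i x : Omega x -> {for x, continuous (fun x => phi x ord0 i)}.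
Proof. exact: C1_continuous. Qed.

Let cPhi i : continuous (Phi i).
Proof.
apply: (continuous_ext0 oO clK KO); first exact: phi0.
exact: cphi.
Qed.

Let psi i := ext0 Omega (fun x => partial g i x * phi x ord0 i).

Let psi0 i x : Omega x -> ~ K x -> partial g i x * phi x ord0 i = 0.
Proof. by move=> Ox nKx; rewrite phi0// mulr0. Qed.

Let cpart i x : Omega x ->
  {for x, continuous (fun x => partial g i x * phi x ord0 i)}.
Proof.
move=> Ox; apply: (@continuousM R); last exact: cphi.
by have [] := gO i Ox.
Qed.

Let cpsi i : continuous (psi i).
Proof. exact: (continuous_ext0 oO clK KO (@psi0 i) (@cpart i)). Qed.

Lemma gdot0 x : Omega x -> ~ K x -> gdot g phi x = 0.
Proof. by move=> Ox nKx; rewrite /gdot big1// => i _; exact: psi0. Qed.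

Lemma continuous_gdot x : Omega x -> {for x, continuous (gdot g phi)}.
Proof. by move=> Ox; apply: continuous_at_sum => i; exact: cpart. Qed.

Lemma integrable_gdot : (lebesgue_rV R n).-integrable Omega (EFin \o gdot g phi).
Proof.
exact: (compact_support_integrable oO bO cK KO gdot0 continuous_gdot).
Qed.

Let ext0_gdot x : ext0 Omega (gdot g phi) x = \sum_i psi i x.
Proof.
have [Ox|nOx] := pselect (Omega x).
  by rewrite ext0_in//; apply: eq_bigr => i _; rewrite /psi ext0_in.
by rewrite ext0_out// big1// => i _; rewrite /psi ext0_out.
Qed.

(** On each cube the summand divided by the volume is compared with grad g . phi. If the tag is in
    the support, the cube lies in [Omega] and [dif_approx] applies. Otherwise the summand vanishes,
    and grad g . phi is small on the cube because [phi] is close to its value 0 at the tag. *)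
Lemma dis_sum_cvg (a b : 'rV[R]_n) : (forall i, a ord0 i < b ord0 i) ->
  K `<=` cell a b -> forall eps, 0 < eps -> exists2 delta, 0 < delta &
  forall (s : 'I_n -> seq R) (tag : cube s -> 'rV[R]_n),
    is_partition a b s -> (forall j, dcube a b j (tag j)) ->
    mesh a b s < delta ->
    `|dis_sum a b (ext0 Omega g) (ext0 Omega phi) tag
      - \int[lebesgue_rV R n]_(x in Omega) gdot g phi x| < eps.
Proof.
move=> ab Kab eps eps0.
have [M M0 gM] := C1_closure_bounded.
have cG : continuous (ext0 Omega (gdot g phi)).
  exact: (continuous_ext0 oO clK KO gdot0 continuous_gdot).
have [B B0 GB] := compact_support_bounded cK cG (off gdot0).
pose V := \prod_i (b ord0 i - a ord0 i).
have V0 : 0 < V by apply: prodr_gt0 => i _; rewrite subr_gt0.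
(* The [n] directions add up to an error of eps * n / (n + 1) < eps. *)
pose e' := eps / (V * n.+1%:R); have e'0 : 0 < e' by rewrite divr_gt0// mulr_gt0.
(* [M * e1] pays for moving [phi] under a factor bounded by [M], and [e1] for moving the product. *)
pose e1 := e' / (M + 1); have e10 : 0 < e1 by rewrite divr_gt0// addr_gt0.
have e1E : M * e1 + e1 = e' by rewrite /e1; field; rewrite gt_eqF// addr_gt0.
have : \forall d \near (0 : R)^'+, forall i x y,
    (forall k, `|x ord0 k - y ord0 k| < d) ->
    `|Phi i x - Phi i y| < e1 /\ `|psi i x - psi i y| < e1.
  apply: filter_forall => i.
  have := unif_continuous_compact_support cK (cPhi (i := i)) (off (phi0 i)) e10.
  have := unif_continuous_compact_support cK (cpsi (i := i)) (off (@psi0 i)) e10.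
  by apply: filterS2 => d h1 h2 x y xy; split; [exact: h2|exact: h1].
(* Below this mesh size, a cube that meets the support is contained in [Omega]. *)
have : \forall d \near (0 : R)^'+, forall x y, K x ->
    (forall k, `|x ord0 k - y ord0 k| < d) -> Omega y.
  apply: compact_uniform => // x /KO Ox.
  have /nbhs_rVP[r r0 xr] : nbhs x Omega by exact: open_nbhs_nbhs.
  by exists r => // x' y _; exact: xr.
move=> KOn ucn; have [d d0 [Hsep Huc]] := near0_gt0 (filterI KOn ucn).
exists d => // s tag part tagP meshd.
have tagC (j : cube s) : ccube a b j (tag j) by have [e _ <-] := tagP j; exact: vertex_ccube.
have close (j : cube s) x y : ccube a b j x -> ccube a b j y ->
    forall k, `|x ord0 k - y ord0 k| < d.
  move=> jx jy k; apply: le_lt_trans (ccube_dist k jx jy) _.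
  by apply: le_lt_trans meshd; exact: width_le_mesh.
pose t (j : cube s) := \sum_i dif a b (ext0 Omega g) i j / width a b j i * Phi i (tag j).
have -> : dis_sum a b (ext0 Omega g) (ext0 Omega phi) tag =
    \sum_j t j * \prod_i width a b j i.
  apply: eq_bigr => j _; rewrite mulr_suml; apply: eq_bigr => i _.
  rewrite ext0_phi [in RHS](bigD1 i)//=; have w0 := width_gt0 part j i.
  by field; rewrite gt_eqF.
rewrite (@Rintegral_ext0 _ _ _ (hcell a b)); first last.
- apply: zero_off_hcell => // x nabx; apply: (off gdot0) => Kx.
  exact: nabx (Kab x Kx).
- exact: measurable_hcell.
- exact: open_measurable_rV.
have mG : measurable_fun (hcell a b) (ext0 Omega (gdot g phi)).
  exact: measurable_funS (measurable_fun_continuous openT (fun x _ => cG x)).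
have tG (j : cube s) x : hcube a b j x -> `|t j - ext0 Omega (gdot g phi) x| <= e' *+ n.
  move=> /hcube_ccube jx; rewrite ext0_gdot /t -sumrB.
  apply: le_trans (ler_norm_sum _ _ _) _.
  rewrite -[X in _ *+ X]card_ord -sumr_const; apply: ler_sum => i _.
  have [Kt|nKt] := pselect (K (tag j)); last first.
    rewrite {1}/Phi (off (phi0 i) nKt) mulr0 sub0r normrN /psi.
    have [Ox|nOx] := pselect (Omega x); last by rewrite ext0_out// normr0 ltW.
    rewrite ext0_in// normrM -e1E ler_wpDr ?(ltW e10)// ler_pM//; first exact: gM.
    have [] := Huc i x (tag j) (close j _ _ jx (tagC j)).
    by rewrite /Phi (off (phi0 i) nKt) subr0 ext0_in// => /ltW.
  have w0 := width_gt0 part j i.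
  rewrite -(ler_pM2r w0) -[X in _ * X <= _](gtr0_norm w0) -normrM mulrBl.
  rewrite (_ : dif a b (ext0 Omega g) i j / width a b j i * Phi i (tag j) * width a b j i =
    dif a b (ext0 Omega g) i j * Phi i (tag j)); last by field; rewrite gt_eqF.
  apply: (dif_approx part) => y jy.
  have Oy : Omega y by apply: (Hsep _ _ Kt) => k; exact: close (tagC j) jy k.
  have gy := near_ext0 g oO Oy.
  have [dy _] := gO i Oy.
  split; first exact: near_eq_derivable gy dy.
  have <- : partial g i y = partial (ext0 Omega g) i y by exact: near_eq_derive.
  (* The field moves from the tag to [y], where the derivative is taken; then the whole product
     moves from [y] to [x]. *)
  have -> : partial g i y * Phi i (tag j) - psi i x =
      partial g i y * (Phi i (tag j) - Phi i y) + (psi i y - psi i x).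
    by rewrite mulrBr {3}/Phi /psi !(ext0_in _ Oy); ring.
  apply: le_trans (ler_normD _ _) _; rewrite -e1E normrM lerD//.
    rewrite ler_pM//; first exact: gM.
    by have [/ltW] := Huc i _ _ (close j _ _ (tagC j) jy).
  by have [_ /ltW] := Huc i _ _ (close j _ _ jy jx).
apply: le_lt_trans (Riemann_sum_error part mG (fun x _ => GB x) tG) _.
rewrite -/V -mulr_natr /e'.
rewrite [ltLHS](_ : _ = eps * (n%:R / n.+1%:R)); last first.
  have : n.+1%:R != 0 :> R by rewrite pnatr_eq0.
  by move: n.+1%:R => m m0; field; rewrite m0 gt_eqF.
by rewrite gtr_pMr// ltr_pdivrMr// mul1r ltr_nat.
Qed.

Let P i x := partial (fun y => g y * phi y ord0 i) i x.

Let PE i x : Omega x ->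
  P i x = g x * partial (fun y => phi y ord0 i) i x + partial g i x * phi x ord0 i.
Proof.
move=> Ox; rewrite /P (partialM (a := g)) 1?[phi x ord0 i * _]mulrC//.
  by have [] := gO i Ox.
by have [] := phi_i_C1 i i Ox.
Qed.

Let gphi_C1 i : C1 Omega (fun y => g y * phi y ord0 i).
Proof. exact: C1M. Qed.

Let gphi0 i x : Omega x -> ~ K x -> g x * phi x ord0 i = 0.
Proof. by move=> Ox nKx; rewrite phi0// mulr0. Qed.

Let P0 i x : Omega x -> ~ K x -> P i x = 0.
Proof. exact: (partial_out oO clK (gphi0 i)). Qed.

Let iP i : (lebesgue_rV R n).-integrable Omega (EFin \o P i).
Proof.
apply: (compact_support_integrable oO bO cK KO (P0 i)) => x Ox.
by have [] := gphi_C1 i i Ox.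
Qed.

Let intP i : \int[lebesgue_rV R n]_(x in Omega) P i x = 0.
Proof.
have [M M0 KM] := bounded_rVP (compact_bounded cK).
rewrite (@Rintegral_ext0 _ _ _ (hcell (const_mx (- M)) (const_mx M))).
- rewrite -(partial_ext0 oO clK KO (gphi0 i)).
  apply: (Rintegral_partial i cK M0 KM).
    exact: (C1_ext0 oO clK KO (gphi0 i) (gphi_C1 i)).
  exact: off (gphi0 i).
- exact: open_measurable_rV.
- exact: measurable_hcell.
- move=> x nx; apply: (off (P0 i)) => Kx; apply: nx => k.
  have := KM x Kx k; rewrite /= in_itv/= !mxE ltr_norml.
  by move=> /andP[/ltW -> ->].
Qed.

Lemma integral_div :
  (\int[lebesgue_rV R n]_(x in Omega) (g x * div phi x)%:E =
   (- \int[lebesgue_rV R n]_(x in Omega) gdot g phi x)%:E)%E.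
Proof.
have mO := open_measurable_rV oO.
have [iS ES] := Rintegral_sum (index_enum 'I_n) mO iP.
have E x : Omega x -> g x * div phi x = \sum_i P i x - gdot g phi x.
  move=> Ox; rewrite /div mulr_sumr /gdot -sumrB; apply: eq_bigr => i _.
  by rewrite PE// addrK.
have iD : (lebesgue_rV R n).-integrable Omega
    (EFin \o (fun x => \sum_i P i x - gdot g phi x)).
  by apply: (eq_integrable mO _ _ _ (integrableB mO iS integrable_gdot)).
transitivity (\int[lebesgue_rV R n]_(x in Omega) (\sum_i P i x - gdot g phi x)%:E)%E.
  by apply: eq_integral => x; rewrite inE => Ox; rewrite E.
rewrite -[LHS]fineK; last exact: (integrable_fin_num mO iD).
congr EFin; rewrite -[LHS]/(Rintegral _ _ _) RintegralB//; last exact: integrable_gdot.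
by rewrite ES big1 ?sub0r.
Qed.

End OneField.
End DualPairing.
End Field.

(** * Reduction of both suprema to one *)

Section Duality.
Context {R : realType} {n : nat}.
Variables (Omega : set 'rV[R]_n) (f g : 'rV[R]_n -> R) (d : R).
Hypotheses (oO : open Omega) (bO : bounded_set Omega) (gC1 : C1_closure Omega g).
Variable C : (set 'rV[R]_n)^nat.
Hypothesis hC : admissible_cover Omega C.

(** The interiors of the increasing sets [C j.+1] cover [Omega], so one of the sets contains the
    compact [K]. *)
Lemma cover_compact (K : set 'rV[R]_n) : compact K -> K `<=` Omega ->
  exists k, K `<=` C k.
Proof.
move=> cK KO; have [Cj OC] := hC.
have Cmono j k : (j <= k)%N -> C j `<=` C k.
  elim: k => [|k IH]; first by rewrite leqn0 => /eqP ->.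
  rewrite leq_eqVlt => /orP[/eqP -> //|]; rewrite ltnS => /IH jk x /jk Ckx.
  by have [_ _ _ CC] := Cj k; exact: interior_subset (CC _ Ckx).
have /compact_near_coveringP/(_ nat \oo (fun k x => C k x) _) := cK.
case.
  move=> x /KO; rewrite OC => -[j _ Cjx].
  exists (C j.+1, [set k | (j.+1 <= k)%N]) => /=.
    split; last by exists j.+1.
    by have [_ _ _ CC] := Cj j; exact: CC.
  by move=> [y k] /= [Cy jk]; exact: Cmono jk _ Cy.
by move=> k _ /(_ k (leqnn k)) Kk; exists k.
Qed.

Lemma gdot_is_PEACE_dis phi : C1c Omega phi ->
  is_PEACE_dis Omega g C phi (\int[lebesgue_rV R n]_(x in Omega) gdot g phi x).
Proof.
move=> phiC1 k a b suppC ab Cab eps eps0.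
by apply: dis_sum_cvg => //; exact: subset_trans suppC Cab.
Qed.

(** The limit property would hold vacuously if no set of the cover contained the support. One such
    set, a cell around it and a fine enough uniform grid force any two limits to agree. *)
Lemma is_PEACE_dis_uniq phi l l' : C1c Omega phi ->
  is_PEACE_dis Omega g C phi l -> is_PEACE_dis Omega g C phi l' -> l = l'.
Proof.
move=> [_ cK KO] hl hl'; have [k Kk] := cover_compact cK KO.
have [M M0 CM] : exists2 M, 0 < M & forall x, C k x -> forall i, `|x ord0 i| < M.
  by apply/bounded_rVP/compact_bounded; have [Cj _] := hC; have [] := Cj k.
pose a : 'rV[R]_n := const_mx (- M); pose b : 'rV[R]_n := const_mx M.
have ab i : a ord0 i < b ord0 i by rewrite !mxE gtrN.
have Cab : C k `<=` cell a b.
  by move=> x Cx i; have := CM x Cx i; rewrite !mxE ltr_norml => /andP[/ltW -> /ltW ->].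
apply/eqP; rewrite -subr_eq0 -normr_eq0; apply/eqP/le_anti; rewrite normr_ge0 andbT.
apply/ler_addgt0Pl => e e0; rewrite addr0.
have e20 : 0 < e / 2 by rewrite divr_gt0.
have [d1 d10 H1] := hl k a b Kk ab Cab _ e20.
have [d2 d20 H2] := hl' k a b Kk ab Cab _ e20.
have d120 : 0 < Num.min d1 d2 by rewrite lt_min d10.
have [N N0] := mesh_upart ab d120; rewrite lt_min => /andP[m1 m2].
set s := upart a b N in m1 m2.
have part : is_partition a b s := upart_partition ab N0.
pose tag (j : cube s) := vertex a b j finset.set0.
have tagP j : dcube a b j (tag j) by exists finset.set0.
have h1 := H1 s tag part tagP m1; have h2 := H2 s tag part tagP m2.
rewrite (splitr e) -(subrKA (dis_sum a b (ext0 Omega g) (ext0 Omega phi) tag)).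
by rewrite (le_trans (ler_normD _ _))// lerD// ltW// distrC.
Qed.

Lemma PEACE_dis_ofE phi : C1c Omega phi ->
  PEACE_dis_of Omega g C phi = \int[lebesgue_rV R n]_(x in Omega) gdot g phi x.
Proof.
move=> phiC1; rewrite /PEACE_dis_of; have h := gdot_is_PEACE_dis phiC1.
by case: xgetP => [l -> hl|/(_ _ h)//]; exact: is_PEACE_dis_uniq hl h.
Qed.

Lemma C1cN phi : C1c Omega phi -> C1c Omega (fun x => - phi x).
Proof.
move=> [phiC1 cK KO]; have E : supp Omega (fun x => - phi x) = supp Omega phi.
  by congr closure; apply/seteqP; split => x /=; rewrite oppr_eq0.
split; [|by rewrite E|by rewrite E].
move=> i x Ox; have [dphi cphi] := phiC1 i x Ox.
split; first exact: derivableN.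
apply: (@near_eq_continuous _ _ _ (fun y => - partial phi i y)).
  have : nbhs x Omega by exact: open_nbhs_nbhs.
  apply: filterS => y Oy; have [dy _] := phiC1 i y Oy.
  exact: esym (deriveN dy).
exact: continuousN.
Qed.

Lemma enormN (v : 'rV[R]_n) : enorm (- v) = enorm v.
Proof. by congr Num.sqrt; apply: eq_bigr => i _; rewrite mxE sqrrN. Qed.

Lemma admissibleN phi : admissible Omega f d phi ->
  admissible Omega f d (fun x => - phi x).
Proof. by move=> [/C1cN h hf]; split => // x Ox; rewrite enormN hf. Qed.

Lemma gdotN phi x : gdot g (fun y => - phi y) x = - gdot g phi x.
Proof.
by rewrite /gdot -sumrN; apply: eq_bigr => i _; rewrite mxE mulrN.
Qed.

Definition pairing : \bar R :=
  ereal_sup [set (\int[lebesgue_rV R n]_(x in Omega) gdot g phi x)%:E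
            | phi in admissible Omega f d].

Lemma PEACE_dis_pairing : PEACE_dis Omega f g d C = pairing.
Proof.
congr ereal_sup; apply/seteqP; split => _ [phi Aphi <-]; exists phi => //;
  by rewrite PEACE_dis_ofE//; case: Aphi.
Qed.

Lemma PEACE_pairing : PEACE Omega f g d = pairing.
Proof.
have NE phi : admissible Omega f d phi ->
    (- \int[lebesgue_rV R n]_(x in Omega) gdot g phi x)%R =
    \int[lebesgue_rV R n]_(x in Omega) gdot g (fun y => - phi y) x.
  move=> [phiC1 _].
  rewrite -mulN1r -RintegralZl; last exact: integrable_gdot.
    by apply: eq_Rintegral => x _; rewrite gdotN mulN1r.
  exact: open_measurable_rV.
congr ereal_sup; apply/seteqP; split => _ [phi Aphi <-].
  exists (fun x => - phi x); first exact: admissibleN.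
  by rewrite integral_div ?NE//; case: Aphi.
exists (fun x => - phi x); first exact: admissibleN.
rewrite integral_div//; last by case: (admissibleN Aphi).
congr EFin; rewrite NE; last exact: admissibleN.
by apply: eq_Rintegral => x _; rewrite !gdotN opprK.
Qed.

End Duality.

(** * Bump functions and fields on a grid *)

Section Bump.
Context {R : realType}.
Implicit Types (s t : R).

(** The square is the lowest integer power of the positive part that is C^1; the cut-off is composed
    from it and polynomials. *)
Definition pos_sqr s : R := Num.max s 0 ^+ 2.

Lemma is_derive_pos_sqr s : is_derive s 1 pos_sqr (2 * Num.max s 0).
Proof.
have key (r : R) : r != 0 ->
    `|2 * Num.max s 0 - r^-1 *: (pos_sqr (r *: 1 + s) - pos_sqr s)| <= `|r|.
  (* Multiplied by |r|, the claim becomes a quadratic inequality with right-hand side r^2, settled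
     by the signs of [s] and [r + s]. *)
  move=> r0; rewrite [r%:A]mulr1 -(ler_pM2l (_ : 0 < `|r|)) ?normr_gt0// -normrM.
  rewrite -normrM -expr2 [leRHS]ger0_norm ?sqr_ge0// mulrBr.
  have -> : r * (r^-1 *: (pos_sqr (r + s) - pos_sqr s)) = pos_sqr (r + s) - pos_sqr s.
    exact: mulVKf.
  rewrite /pos_sqr ler_norml.
  by case: (leP s 0) => s0; case: (leP (r + s) 0) => rs0; apply/andP; split; nra.
have dlim : (fun r : R => r^-1 *: ((pos_sqr \o shift s) (r *: 1) - pos_sqr s))
    @ 0^' --> 2 * Num.max s 0.
  apply/cvgrPdist_le => e e0; near=> r.
  apply: le_trans (key r _) _.
    by near: r; exact: nbhs_dnbhs_neq.
  by near: r; apply: dnbhs0_le.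
apply: DeriveDef; first by apply/cvg_ex; exists (2 * Num.max s 0).
exact: cvg_lim dlim.
Unshelve. all: by end_near. Qed.

Lemma continuous_pos_part : continuous (fun s : R => Num.max s 0).
Proof. by move=> s; apply: continuous_max => //; exact: cst_continuous. Qed.

Lemma pos_sqr_ge0 s : 0 <= pos_sqr s. Proof. exact: sqr_ge0. Qed.

Lemma pos_sqr_le0 s : s <= 0 -> pos_sqr s = 0.
Proof. by move=> s0; rewrite /pos_sqr max_r// expr0n. Qed.

(* C^1, zero outside ]e, 1 - e[, and equal to 1 as soon as
   M (t (1 - t) - e)^2 >= 1, hence at any given point of ]0, 1[ when e is small
   and M large. *)
Definition bump (e M t : R) : R := 1 - pos_sqr (1 - M * pos_sqr (t * (1 - t) - e)).

Definition dbump (e M t : R) : R :=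
  4 * M * Num.max (1 - M * pos_sqr (t * (1 - t) - e)) 0 *
  Num.max (t * (1 - t) - e) 0 * (1 - 2 * t).

Lemma is_derive_bump e M t : is_derive t 1 (bump e M) (dbump e M t).
Proof.
pose q s : R := s * (1 - s) - e.
have dq : is_derive t 1 q (1 - 2 * t).
  rewrite /q; apply: is_derive_eq.
  by rewrite /GRing.scale/=; ring.
have d1 : is_derive t 1 (pos_sqr \o q) (2 * Num.max (q t) 0 * (1 - 2 * t)).
  exact: is_derive1_comp (is_derive_pos_sqr _) dq.
pose p s : R := 1 - M * (pos_sqr \o q) s.
have d2 : is_derive t 1 p (- M * (2 * Num.max (q t) 0 * (1 - 2 * t))).
  rewrite /p; apply: is_derive_eq.
  by rewrite /GRing.scale/=; ring.
have d3 : is_derive t 1 (pos_sqr \o p)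
    (2 * Num.max (p t) 0 * (- M * (2 * Num.max (q t) 0 * (1 - 2 * t)))).
  exact: is_derive1_comp (is_derive_pos_sqr _) d2.
rewrite (_ : bump e M = (fun s => 1 - (pos_sqr \o p) s))//.
apply: is_derive_eq.
by rewrite /GRing.scale/= /dbump /p /q /=; ring.
Qed.

Lemma continuous_compose (h k : R -> R) :
  continuous h -> continuous k -> continuous (k \o h).
Proof. by move=> ch ck t; exact: continuous_comp (ch t) (ck _). Qed.

Lemma continuous_dbump e M : continuous (dbump e M).
Proof.
have cq : continuous (fun t : R => t * (1 - t) - e).
  move=> t; apply: cvgB; last exact: cvg_cst.
  by apply: cvgM => //; apply: cvgB => //; exact: cvg_cst.
have cs : continuous pos_sqr.
  move=> s; apply: differentiable_continuous; apply/derivable1_diffP.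
  exact: (@ex_derive _ _ _ _ _ _ _ (is_derive_pos_sqr s)).
have c1 : continuous (fun t : R => Num.max (t * (1 - t) - e) 0).
  exact: continuous_compose cq continuous_pos_part.
have c2 : continuous (fun t : R => pos_sqr (t * (1 - t) - e)).
  exact: continuous_compose cq cs.
have c3 : continuous (fun t : R => 1 - M * pos_sqr (t * (1 - t) - e)).
  move=> t; apply: cvgB; first exact: cvg_cst.
  by apply: cvgM; [exact: cvg_cst|exact: c2].
have c4 : continuous (fun t : R => Num.max (1 - M * pos_sqr (t * (1 - t) - e)) 0).
  exact: continuous_compose c3 continuous_pos_part.
move=> t; apply: cvgM; last first.
  by apply: cvgB; [exact: cvg_cst|apply: cvgM => //; exact: cvg_cst].
apply: cvgM; last exact: c1.
by apply: cvgM; [exact: cvg_cst|exact: c4].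
Qed.

Lemma bump_ge0 e M t : 0 <= M -> 0 <= bump e M t.
Proof.
move=> M0; rewrite /bump subr_ge0 /pos_sqr expr_le1 ?le_max ?lexx ?orbT//.
by rewrite ge_max ler01 andbT gerBl mulr_ge0// pos_sqr_ge0.
Qed.

Lemma bump_le1 e M t : bump e M t <= 1.
Proof. by rewrite /bump gerBl pos_sqr_ge0. Qed.

Lemma bump_out e M t : 0 <= e -> t <= e \/ 1 - e <= t -> bump e M t = 0.
Proof.
move=> e0 te; have q0 : t * (1 - t) - e <= 0 by case: te => te; nra.
rewrite /bump (pos_sqr_le0 q0) mulr0 subr0 /pos_sqr max_l ?ler01// expr1n.
by rewrite subrr.
Qed.

Lemma bump_eventually1 t : 0 < t < 1 ->
  \forall m \near \oo, bump m.+1%:R^-1 m.+1%:R t = 1.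
Proof.
move=> /andP[t0 t1]; have : 0 < t * (1 - t) by rewrite mulr_gt0// subr_gt0.
rewrite /bump; move: (t * (1 - t)) => u u0.
near=> m; have m0 : 0 < m.+1%:R :> R by rewrite ltr0n.
(* With N = m + 1, the two terms give N u^2 >= 4 and 1/N <= u/2, so that N (u - 1/N)^2 >= N u^2 / 4
   >= 1. *)
have mu : (4 / u ^+ 2 + 2 / u) <= m.+1%:R.
  near: m; exists (Num.truncn (4 / u ^+ 2 + 2 / u)) => // m /= Hm.
  by apply: le_trans (ltW (truncnS_gt _)) _; rewrite ler_nat ltnS.
have u4 : 0 < 4 / u ^+ 2 by rewrite divr_gt0// exprn_gt0.
have u2 : 0 < 2 / u by rewrite divr_gt0.
have h1 : 4 <= m.+1%:R * u ^+ 2 by rewrite -ler_pdivrMr ?exprn_gt0//; lra.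
have h2 : m.+1%:R^-1 <= u / 2.
  have h0 : 2 <= m.+1%:R * u by rewrite -ler_pdivrMr//; lra.
  by rewrite -div1r ler_pdivrMr// mulrAC ler_pdivlMr// mul1r mulrC.
move: (m.+1%:R^-1) h2 => v h2; have h3 : u / 2 <= u - v by lra.
rewrite pos_sqr_le0 ?subr0// subr_le0.
have -> : pos_sqr (u - v) = (u - v) ^+ 2.
  by rewrite /pos_sqr max_l//; lra.
have h4 : (u / 2) ^+ 2 <= (u - v) ^+ 2.
  by rewrite lerXn2r ?nnegrE//; lra.
have : m.+1%:R * (u / 2) ^+ 2 <= m.+1%:R * (u - v) ^+ 2 by rewrite ler_pM2l.
apply: le_trans; rewrite expr_div_n mulrA ler_pdivlMr ?exprn_gt0// mul1r.
by rewrite -natrX.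
Unshelve. all: by end_near. Qed.

End Bump.

Section SmoothProducts.
Context {R : realType} {n : nat}.
Implicit Types (x y : 'rV[R]_n).

Lemma C1_cst (c : R) : C1 [set: 'rV[R]_n] (cst c).
Proof.
move=> i x _; split; first exact: derivable_cst.
rewrite (_ : partial _ _ = cst 0); first exact: (@cst_continuous _ _ (0 : R) x).
by apply/funext => y; rewrite /partial derive_cst.
Qed.

Lemma C1_coord_fun (beta dbeta : R -> R) (i : 'I_n) :
  (forall t : R, is_derive t 1 beta (dbeta t)) -> continuous dbeta ->
  C1 setT (fun x : 'rV[R]_n => beta (x ord0 i)).
Proof.
move=> db cdb; pose F x : R := beta (x ord0 i); rewrite -/F.
have dF k x : is_derive x (delta_mx ord0 k) F ((i == k)%:R * dbeta (x ord0 i)).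
  have E : (fun r : R => r^-1 *: ((F \o shift x) (r *: delta_mx ord0 k) - F x)) =
      (fun r : R => r^-1 *: ((beta \o shift (x ord0 i)) (r * (i == k)%:R) - beta (x ord0 i))).
    by apply/funext => r; rewrite /F /= delta_lineE.
  have [ik|ik] := eqVneq i k.
    have [d1 d2] := db (x ord0 i); rewrite mul1r.
    suff E' : (fun r : R => r^-1 *: ((F \o shift x) (r *: delta_mx ord0 k) - F x)) =
      (fun r : R => r^-1 *: ((beta \o shift (x ord0 i)) (r *: 1) - beta (x ord0 i))).
      by apply: DeriveDef; rewrite /derivable /derive E'.
    by rewrite E ik eqxx.
  rewrite mul0r.
  suff E' : (fun r : R => r^-1 *: ((F \o shift x) (r *: delta_mx ord0 k) - F x)) = cst 0.
    apply: DeriveDef; rewrite /derivable /derive E'; first exact: is_cvg_cst.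
    exact: lim_cst.
  by rewrite E; apply/funext => r /=; rewrite (negPf ik) mulr0 add0r subrr scaler0.
move=> k x _; split; first exact: (@ex_derive _ _ _ _ _ _ _ (dF k x)).
rewrite (_ : partial F k = (fun x => (i == k)%:R * dbeta (x ord0 i))).
  apply: (@continuousM R); first exact: (@cst_continuous _ _ _ x).
  exact: (@continuous_comp _ _ _ (fun x : 'rV[R]_n => x ord0 i) dbeta x
    (@continuous_coord _ _ i x) (cdb _)).
by apply/funext => y; rewrite /partial (@derive_val _ _ _ _ _ _ _ (dF k y)).
Qed.

Lemma C1_prod (I : Type) (r : seq I) (F : I -> 'rV[R]_n -> R) :
  (forall i, C1 setT (F i)) -> C1 setT (fun x => \prod_(i <- r) F i x).
Proof.
move=> FC1; elim: r => [|i r IH].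
  rewrite (_ : (fun _ => _) = cst 1); first exact: C1_cst.
  by apply/funext => y; rewrite big_nil.
rewrite (_ : (fun _ => _) = (fun x => F i x * \prod_(j <- r) F j x)).
  exact: (C1M openT (FC1 i) IH).
by apply/funext => y; rewrite big_cons.
Qed.

End SmoothProducts.

(** * Fields subordinate to a grid *)

Section Grid.
Context {R : realType}.

Lemma floorP (t : R) : (Num.floor t)%:~R <= t < (Num.floor t)%:~R + 1.
Proof. by have := real_floor_itv (num_real t); rewrite intrD. Qed.

Lemma floor_uniq (t : R) (z : int) : z%:~R <= t < z%:~R + 1 -> Num.floor t = z.
Proof. by move=> h; apply: floor_def; rewrite intrD. Qed.

(* On both sides of a grid point the bump vanishes, so that re-centring it at a
   neighbouring cell changes nothing. *)
Lemma bump_floor_near (e M t0 : R) : 0 < e -> e <= 1 ->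
  \forall t \near t0, Num.floor t = Num.floor t0 \/
    bump e M (t - (Num.floor t0)%:~R) = 0 /\ bump e M (t - (Num.floor t)%:~R) = 0.
Proof.
move=> e0 e1; set z := Num.floor t0.
have /andP[zt0 t0z] : z%:~R <= t0 < z%:~R + 1 := floorP t0.
move: zt0; rewrite le_eqVlt => /orP[/eqP zt0|zt0].
  near=> t.
  have : `|t0 - t| < e by near: t; exact: (nbhsx_ballx t0 e e0).
  rewrite -zt0 ltr_distlC => /andP[h1 h2].
  have [zt|tz] := leP z%:~R t.
    by left; apply: floor_uniq; rewrite zt/= (lt_le_trans h2)// lerD2l.
  right; have -> : Num.floor t = z - 1.
    by apply: floor_uniq; rewrite intrB subrK tz andbT; lra.
  by rewrite intrB !bump_out//; lra.
near=> t; left; apply: floor_uniq; apply/andP; split; last by near: t; exact: lt_nbhsl.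
by apply: ltW; near: t; exact: lt_nbhsr.
Unshelve. all: by end_near. Qed.

Context {n : nat}.
Implicit Types (x y : 'rV[R]_n) (z : 'I_n -> int).

Definition dotv (u v : 'rV[R]_n) : R := \sum_i u ord0 i * v ord0 i.

Lemma dotvZr u (c : R) v : dotv u (c *: v) = c * dotv u v.
Proof. by rewrite /dotv mulr_sumr; apply: eq_bigr => i _; rewrite !mxE mulrCA. Qed.

Lemma dotvv u : dotv u u = enorm u ^+ 2.
Proof.
rewrite sqr_sqrtr; first by apply: eq_bigr => i _; rewrite expr2.
by apply: sumr_ge0 => i _; exact: sqr_ge0.
Qed.

Lemma enorm_ge0 (u : 'rV[R]_n) : 0 <= enorm u. Proof. exact: sqrtr_ge0. Qed.

Lemma enormZ (c : R) (u : 'rV[R]_n) : enorm (c *: u) = `|c| * enorm u.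
Proof.
rewrite /enorm -sqrtr_sqr -sqrtrM ?sqr_ge0// mulr_sumr.
by congr Num.sqrt; apply: eq_bigr => i _; rewrite mxE exprMn.
Qed.

Lemma enorm0 : enorm (0 : 'rV[R]_n) = 0.
Proof. by rewrite -(scale0r 0) enormZ normr0 mul0r. Qed.

Lemma enorm_eq0 (u : 'rV[R]_n) : enorm u = 0 -> u = 0.
Proof.
move=> u0; apply/rowP => i; rewrite mxE; apply/eqP; rewrite -normr_eq0.
by rewrite eq_le normr_ge0 andbT -u0 coord_le_enorm.
Qed.

(** Cauchy-Schwarz, from summing the squares (|v| u_i - |u| v_i)^2; the factor 2 |u| |v| cancels
    once both norms are nonzero. *)
Lemma dotv_le u v : dotv u v <= enorm u * enorm v.
Proof.
have [/enorm_eq0 ->|u0] := eqVneq (enorm u) 0.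
  by rewrite enorm0 mul0r /dotv big1// => i _; rewrite mxE mul0r.
have [/enorm_eq0 ->|v0] := eqVneq (enorm v) 0.
  by rewrite enorm0 mulr0 /dotv big1// => i _; rewrite mxE mulr0.
have A : 0 < enorm u by rewrite lt_def u0 enorm_ge0.
have B : 0 < enorm v by rewrite lt_def v0 enorm_ge0.
have : 2 * (enorm u * enorm v) * dotv u v <=
    enorm v ^+ 2 * dotv u u + enorm u ^+ 2 * dotv v v.
  rewrite /dotv !mulr_sumr -big_split/=; apply: ler_sum => i _.
  rewrite -subr_ge0.
  by rewrite (_ : _ - _ = (enorm v * u ord0 i - enorm u * v ord0 i) ^+ 2) ?sqr_ge0//; ring.
rewrite !dotvv [X in _ <= X](_ : _ = 2 * (enorm u * enorm v) * (enorm u * enorm v)); last ring.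
by rewrite ler_pM2l// !mulr_gt0.
Qed.

Variables (Omega : set 'rV[R]_n) (g h : 'rV[R]_n -> R).
Hypotheses (oO : open Omega) (bO : bounded_set Omega) (h0 : forall x, 0 <= h x).

Section FixedMesh.
Variable N : R.
Hypothesis N0 : 0 < N.

Definition gcube z : set 'rV[R]_n :=
  [set x | forall i, (z i)%:~R <= N * x ord0 i <= (z i)%:~R + 1].

Definition gfloor x (i : 'I_n) : int := Num.floor (N * x ord0 i).

Definition gcorner z : 'rV[R]_n := \row_i ((z i)%:~R / N).

(** Since the inverse of 0 is 0, this is the zero vector where the gradient vanishes at the corner;
    otherwise it is a unit vector. *)
Definition gdir z : 'rV[R]_n :=
  let p := grad g (gcorner z) in (enorm p)^-1 *: p.

(* The sign condition makes grad g . phi nonnegative, as Fatou's lemma needs. *)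
Definition ggood z : Prop := gcube z `<=` Omega /\
  forall y, gcube z y -> 0 <= dotv (grad g y) (gdir z).

(** The infimum over the closed cube makes one constant vector satisfy the bound by [h] at all of
    its points. *)
Definition gvec z : 'rV[R]_n :=
  if `[< ggood z >] then inf (h @` gcube z) *: gdir z else 0.

Lemma gcube_floor x : gcube (gfloor x) x.
Proof. by move=> i; have /andP[-> /ltW ->] := floorP (N * x ord0 i). Qed.

Lemma gcube_corner z : gcube z (gcorner z).
Proof. by move=> i; rewrite mxE mulrC divfK ?gt_eqF// lexx lerDl ler01. Qed.

Lemma enorm_gdir z : enorm (gdir z) <= 1.
Proof.
rewrite enormZ ger0_norm ?invr_ge0 ?enorm_ge0//.
set p := grad _ _; have [->|p0] := eqVneq (enorm p) 0; first by rewrite mulr0 ler01.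
by rewrite mulVf.
Qed.

Lemma has_inf_h z : has_inf (h @` gcube z).
Proof.
split; last by exists 0 => _ [y _ <-].
by exists (h (gcorner z)); exists (gcorner z) => //; exact: gcube_corner.
Qed.

Lemma inf_h_ge0 z : 0 <= inf (h @` gcube z).
Proof.
apply: lb_le_inf => [|_ [y _ <-]//]; by have [] := has_inf_h z.
Qed.

Lemma enorm_gvec z x : gcube z x -> enorm (gvec z) <= h x.
Proof.
move=> zx; rewrite /gvec; case: ifP => _; last by rewrite enorm0.
rewrite enormZ ger0_norm ?inf_h_ge0// (@le_trans _ _ (inf (h @` gcube z)))//.
  by rewrite ler_piMr ?inf_h_ge0 ?enorm_gdir.
by apply: ge_inf; [have [] := has_inf_h z|exists x].
Qed.

Lemma dot_gvec_ge0 z x : gcube z x -> 0 <= dotv (grad g x) (gvec z).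
Proof.
move=> zx; rewrite /gvec; case: asboolP => [[_ gz]|_].
  by rewrite dotvZr mulr_ge0 ?inf_h_ge0// gz.
by rewrite /dotv sumr_ge0// => i _; rewrite !mxE mulr0.
Qed.

Section FixedMargin.
Variables (e M : R).
Hypotheses (e0 : 0 < e) (e1 : e <= 1) (M0 : 0 <= M).

Definition gbump z x : R := \prod_i bump e M (N * x ord0 i - (z i)%:~R).

(** Each point consults only its own cube, so no sum over cubes is formed; smoothness across the
    faces comes from the bump vanishing near them. *)
Definition gfield x : 'rV[R]_n := gbump (gfloor x) x *: gvec (gfloor x).

Lemma gbump_ge0 z x : 0 <= gbump z x.
Proof. by apply: prodr_ge0 => i _; exact: bump_ge0. Qed.

Lemma gbump_le1 z x : gbump z x <= 1.
Proof. by apply: prodr_ile1 => i _; rewrite bump_ge0 ?bump_le1. Qed.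

Lemma C1_gbump z : C1 setT (gbump z).
Proof.
apply: C1_prod => i.
apply: (@C1_coord_fun _ _ (fun t => bump e M (N * t - (z i)%:~R))
  (fun t => dbump e M (N * t - (z i)%:~R) * N)) => [t|].
  apply: (@is_derive1_comp _ (bump e M) (fun t => N * t - (z i)%:~R)).
    exact: is_derive_bump.
  by apply: is_derive_eq; rewrite /GRing.scale/=; ring.
have cl : continuous (fun t : R => N * t - (z i)%:~R).
  by move=> t; apply: cvgB; [apply: cvgM => //; exact: cvg_cst|exact: cvg_cst].
have cd : continuous (dbump e M \o (fun t : R => N * t - (z i)%:~R)).
  exact: continuous_compose cl (@continuous_dbump _ e M).
by move=> t; apply: cvgM; [exact: cd|exact: cvg_cst].
Qed.

(** The cube index may be frozen at that of [x0]: if a nearby point has another index in some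
    coordinate, both products contain a vanishing factor. *)
Lemma gfield_near x0 : \forall x \near x0,
  gbump (gfloor x0) x *: gvec (gfloor x0) = gfield x.
Proof.
have : \forall x \near x0, forall i : 'I_n, gfloor x i = gfloor x0 i \/
    bump e M (N * x ord0 i - (gfloor x0 i)%:~R) = 0 /\
    bump e M (N * x ord0 i - (gfloor x i)%:~R) = 0.
  near=> x; move=> i; move: i; near: x; apply: filter_forall => i.
  have cl : {for x0, continuous (fun x : 'rV[R]_n => N * x ord0 i)}.
    apply: (@continuousM R); first exact: (@cst_continuous _ _ _ x0).
    exact: continuous_coord.
  exact: (cl _ (bump_floor_near M (N * x0 ord0 i) e0 e1)).
apply: filterS => x Hx.
have [E|] := pselect (forall i, gfloor x i = gfloor x0 i).
  by rewrite /gfield; have -> : gfloor x = gfloor x0 by exact/funext.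
move=> /existsNP[i ni]; have [//|[b1 b2]] := Hx i.
by rewrite /gfield /gbump (bigD1 i)//= b1 [in RHS](bigD1 i)//= b2 !mul0r !scale0r.
Unshelve. all: by end_near. Qed.

Lemma C1_gfield : C1 setT gfield.
Proof.
apply: C1_rV; first exact: openT.
move=> j k x _.
apply: (@near_eq_C1 _ _ _ (fun y => gbump (gfloor x) y * gvec (gfloor x) ord0 j)).
  by apply: filterS (gfield_near x) => y <-; rewrite mxE.
have H : C1 setT (fun y => gbump (gfloor x) y * cst (gvec (gfloor x) ord0 j) y).
  exact: (C1M openT (@C1_gbump _) (@C1_cst _ _ _)).
exact: (H k x I).
Qed.

(** Where the field is nonzero, the point is more than [e / N] away from the faces of a cube
    contained in [Omega]. A limit of such points therefore still lies in one of these cubes. *)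
Lemma gfield_supp : supp Omega gfield `<=` Omega.
Proof.
move=> x; have : nbhs x [set y | forall i, `|x ord0 i - y ord0 i| < e / N].
  by apply/nbhs_rVP; exists (e / N); rewrite ?divr_gt0.
move=> nx /(_ _ nx)[y [[Oy fy] xy]].
have : ggood (gfloor y).
  apply: contrapT => ng; move: fy; rewrite /gfield /gvec.
  by case: asboolP => //; rewrite scaler0 eqxx.
move=> [+ _]; apply => i.
have : bump e M (N * y ord0 i - (gfloor y i)%:~R) != 0.
  apply: contra fy => /eqP b0.
  by rewrite /gfield /gbump (bigD1 i)//= b0 mul0r scale0r.
have [ye|ye] := leP (N * y ord0 i - (gfloor y i)%:~R) e.
  by rewrite (bump_out M (ltW e0) (or_introl ye)) eqxx.
have [ye'|ye' _] := leP (1 - e) (N * y ord0 i - (gfloor y i)%:~R).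
  by rewrite (bump_out M (ltW e0) (or_intror ye')) eqxx.
have : `|N * x ord0 i - N * y ord0 i| < e.
  by rewrite -mulrBr normrM (gtr0_norm N0) mulrC -ltr_pdivlMr//; exact: xy.
by rewrite ltr_distl => /andP[h1 h2]; apply/andP; split; lra.
Qed.

Lemma gfield_C1c : C1c Omega gfield.
Proof.
split; [by move=> i x _; exact: C1_gfield| |exact: gfield_supp].
apply: bounded_closed_compact; last exact: closed_closure.
have [M' [rM' HM']] := bO; exists M'; split => // k Mk x /gfield_supp Ox.
exact: HM' k Mk x Ox.
Qed.

Lemma enorm_gfield x : enorm (gfield x) <= h x.
Proof.
rewrite enormZ ger0_norm ?gbump_ge0//.
apply: le_trans (enorm_gvec (gcube_floor x)).
by rewrite ler_piMl ?enorm_ge0 ?gbump_le1.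
Qed.

Lemma gdot_gfield x : gdot g gfield x = gbump (gfloor x) x * dotv (grad g x) (gvec (gfloor x)).
Proof.
rewrite -dotvZr /gdot /dotv; by apply: eq_bigr => i _; rewrite [grad _ _ _ _]mxE.
Qed.

Lemma gdot_gfield_ge0 x : 0 <= gdot g gfield x.
Proof. by rewrite gdot_gfield mulr_ge0 ?gbump_ge0 ?dot_gvec_ge0//; exact: gcube_floor. Qed.

End FixedMargin.
End FixedMesh.
End Grid.

(** * The integral formula *)

Section LowerLimits.
Context {R : realType}.
Local Open Scope ereal_scope.

Lemma limn_einf_ge (u : (\bar R)^nat) l :
  (\forall n \near \oo, l <= u n) -> l <= limn_einf u.
Proof.
move=> [N _ Nu]; rewrite limn_einf_lim; apply: lime_ge; first exact: is_cvg_einfs.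
exists N => // m /= Nm; apply: le_ereal_inf_tmp => _ [k /= mk <-].
by apply: Nu => /=; exact: leq_trans mk.
Qed.

Lemma limn_einf_le (u : (\bar R)^nat) l : (forall n, u n <= l) -> limn_einf u <= l.
Proof.
move=> ul; rewrite limn_einf_lim; apply: lime_le; first exact: is_cvg_einfs.
exists 0%N => // m _; apply: le_trans (ul m).
by apply: ereal_inf_lbound; exists m => /=.
Qed.

Lemma measurable_fun_limn_einf d (T : measurableType d) (D : set T)
    (u : (T -> \bar R)^nat) : (forall k, measurable_fun D (u k)) ->
  measurable_fun D (fun x => limn_einf (u ^~ x)).
Proof.
move=> mu; rewrite /limn_einf; apply: measurableT_comp => //.
apply: (@measurable_fun_limn_esup _ _ _ D (fun k x => - u k x)) => k.
exact: measurableT_comp.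
Qed.

End LowerLimits.

(** * Pointwise lower bounds for the grid fields *)

Section Limit.
Context {R : realType} {n : nat}.
Implicit Types (x y : 'rV[R]_n).
Variables (Omega : set 'rV[R]_n) (g h : 'rV[R]_n -> R).
Hypotheses (oO : open Omega) (gC1 : C1 Omega g) (h0 : forall x, 0 <= h x).

Lemma continuous_at_enorm (F : 'rV[R]_n -> 'rV[R]_n) x :
  (forall i, {for x, continuous (fun y => F y ord0 i)}) ->
  {for x, continuous (fun y => enorm (F y))}.
Proof.
move=> cF; apply: (@continuous_comp _ _ _ (fun y => \sum_i F y ord0 i ^+ 2) Num.sqrt x).
  by apply: continuous_at_sum => i; apply: (@continuousM R).
exact: sqrt_continuous.
Qed.

Lemma continuous_grad x i : Omega x ->
  {for x, continuous (fun y => grad g y ord0 i)}.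
Proof.
move=> Ox; rewrite (_ : (fun _ => _) = partial g i).
  by have [] := gC1 i Ox.
by apply/funext => y; rewrite mxE.
Qed.

Lemma gcube_dist (N : R) z x y i : 0 < N -> gcube N z x -> gcube N z y ->
  `|x ord0 i - y ord0 i| <= N^-1.
Proof.
move=> N0 /(_ i)/andP[x1 x2] /(_ i)/andP[y1 y2].
rewrite -(ler_pM2l N0) mulfV ?gt_eqF// -[X in X * _ <= _](gtr0_norm N0) -normrM mulrBr.
by rewrite ler_distl; apply/andP; split; lra.
Qed.

(** The number [s] is split as [t * theta] with t < h(x) and theta < |grad g(x)|. On a small cube
    around [x] the infimum of [h] is at least [t], and grad g(x) has component at least [theta]
    along the direction at the corner. *)
Lemma gvec_liminf x (s : R) : Omega x ->
  (forall t, t < h x -> \forall y \near x, t < h y) ->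
  s < enorm (grad g x) * h x ->
  \forall k \near \oo,
    s <= dotv (grad g x) (gvec Omega g h k.+1%:R (gfloor k.+1%:R x)).
Proof.
move=> Ox lsc sx; set p := grad g x in sx *; set P := enorm p in sx *.
(* The sign condition on good cubes settles this case; below, division by [t] needs s > 0. *)
have [s0|s0] := leP s 0.
  exists 0%N => // k _; apply: le_trans s0 _.
  by apply: dot_gvec_ge0 => //; exact: gcube_floor.
have P0 : 0 < P.
  rewrite lt_def enorm_ge0 andbT; apply: contraTneq sx => ->.
  by rewrite mul0r -leNgt ltW.
have sPh : s / P < h x by rewrite ltr_pdivrMr// mulrC.
pose t := (s / P + h x) / 2; have sP0 : 0 < s / P by rewrite divr_gt0.
have th : t < h x by rewrite /t; lra.
have tsP : s / P < t by rewrite /t; lra.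
have t0 : 0 < t by exact: lt_trans tsP.
pose theta := s / t; have theta0 : 0 < theta by rewrite divr_gt0.
have thetaP : theta < P by rewrite ltr_pdivrMr// mulrC -ltr_pdivrMr.
(* The third condition controls the direction at the corner. The fourth makes the cube good and, as
   theta < P, keeps the gradient at the corner from vanishing. *)
have near_x : \forall y \near x, [/\ Omega y, t < h y,
    theta * enorm (grad g y) <= dotv p (grad g y) &
    enorm (grad g y - p) <= theta].
  have n1 : \forall y \near x, Omega y by exact: open_nbhs_nbhs.
  have n2 := lsc t th.
  have c3 : {for x, continuous (fun y => dotv p (grad g y) - theta * enorm (grad g y))}.
    apply: (@continuousB _ R^o).
      apply: continuous_at_sum => i; apply: (@continuousM R).
        exact: (@cst_continuous _ _ _ x).
      exact: continuous_grad.
    apply: (@continuousM R); first exact: (@cst_continuous _ _ _ x).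
    by apply: continuous_at_enorm => i; exact: continuous_grad.
  have n3 : \forall y \near x, 0 < dotv p (grad g y) - theta * enorm (grad g y).
    apply: (cvgr_gt (F := nbhs x) _ c3).
    by rewrite dotvv -/P expr2 -mulrBl mulr_gt0// subr_gt0.
  have c4 : {for x, continuous (fun y => enorm (grad g y - p))}.
    apply: continuous_at_enorm => i.
    rewrite (_ : (fun _ => _) = (fun y => grad g y ord0 i - p ord0 i)).
      apply: (@continuousB _ R^o); first exact: continuous_grad.
      exact: (@cst_continuous _ _ _ x).
    by apply/funext => y; rewrite !mxE.
  have n4 : \forall y \near x, enorm (grad g y - p) < theta.
    by apply: (cvgr_lt (F := nbhs x) _ c4); rewrite subrr enorm0.
  near=> y; split.
  - by near: y.
  - by near: y.
  - by rewrite -subr_ge0 ltW//; near: y.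
  - by apply: ltW; near: y.
move: near_x => /nbhs_rVP[r r0 xr].
(* The side 1/(k+1) is then less than [r], so the whole cube of [x] lies in the neighbourhood. *)
exists (Num.truncn r^-1) => // k /= Hk; set N : R := k.+1%:R.
have N0 : 0 < N by rewrite ltr0n.
have Nr : N^-1 < r.
  rewrite -[r]invrK ltf_pV2 ?posrE ?invr_gt0//.
  by apply: lt_le_trans (truncnS_gt _) _; rewrite ler_nat ltnS.
set z := gfloor N x; have zx : gcube N z x := gcube_floor N x.
have near_z y : gcube N z y -> [/\ Omega y, t < h y,
    theta * enorm (grad g y) <= dotv p (grad g y) &
    enorm (grad g y - p) <= theta].
  by move=> zy; apply: xr => i; apply: le_lt_trans Nr; exact: gcube_dist zx zy.
have zc := gcube_corner N0 z; set c := gcorner N z in zc.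
have [_ _ c3 c4] := near_z c zc.
have Pc : 0 < enorm (grad g c).
  rewrite lt_def enorm_ge0 andbT; apply: contraTneq c4 => /enorm_eq0 ->.
  by rewrite sub0r enormN -ltNge.
have good : ggood Omega g N z.
  split=> [y /near_z[]//|y zy].
  have [_ _ _ y4] := near_z y zy.
  rewrite /gdir -/c dotvZr mulr_ge0 ?invr_ge0 ?enorm_ge0//.
  (* The first term is at least theta |grad g(c)| and the second at most that, by Cauchy-Schwarz. *)
  have -> : dotv (grad g y) (grad g c) =
      dotv p (grad g c) - dotv (- (grad g y - p)) (grad g c).
    rewrite /dotv -sumrB; apply: eq_bigr => i _; rewrite !mxE; ring.
  rewrite subr_ge0 (le_trans (dotv_le _ _))// enormN (le_trans _ c3)//.
  by rewrite ler_wpM2r ?enorm_ge0.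
rewrite /gvec asboolT// dotvZr /gdir -/c dotvZr.
have -> : s = t * theta by rewrite /theta mulrC divfK// gt_eqF.
rewrite ler_pM ?(ltW t0) ?(ltW theta0)//; last first.
  by rewrite mulrC ler_pdivlMr.
apply: lb_le_inf; first by exists (h x), x.
by move=> _ [y /near_z[_ /ltW ? _ _] <-].
Unshelve. all: by end_near. Qed.

(** Off the grid hyperplanes all fractional parts lie in ]0, 1[, so the finitely many bump factors
    are eventually equal to 1. *)
Lemma gdot_gfield_eventually (N : R) x : 0 < N ->
  (forall i, N * x ord0 i != (gfloor N x i)%:~R) ->
  \forall m \near \oo, gdot g (gfield Omega g h N m.+1%:R^-1 m.+1%:R) x =
    dotv (grad g x) (gvec Omega g h N (gfloor N x)).
Proof.
move=> N0 offgrid.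
have : \forall m \near \oo, forall i : 'I_n,
    bump m.+1%:R^-1 m.+1%:R (N * x ord0 i - (gfloor N x i)%:~R) = 1.
  apply: filter_forall => i; apply: bump_eventually1.
  have /andP[f1 f2] := floorP (N * x ord0 i).
  rewrite subr_gt0 lt_neqAle eq_sym offgrid f1/=.
  by rewrite ltrBlDl.
apply: filterS => m bm; rewrite gdot_gfield /gbump big1 ?mul1r//.
Qed.

(** A single null set that contains the grid hyperplanes of all mesh sizes 1/(k+1). *)
Lemma ae_irrational : {ae lebesgue_rV R n, forall x, forall i (q : rat),
  x ord0 i != ratr q}.
Proof.
have : forall i, {ae lebesgue_rV R n, forall x, forall q : rat, x ord0 i != ratr q}.
  move=> i; pose D : set R := range (fun q : rat => ratr q).
  have cD : countable D by exact: card_le_trans (card_image_le _ _) (countableP _).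
  have mD : measurable D.
    by apply: countable_measurable => // t; exact: measurable_set1.
  exists [set x : 'rV[R]_n | D (x ord0 i)]; split.
  - by rewrite -[X in measurable X]setTI; exact: measurable_coord.
  - exact: (lebesgue_rV_null i mD (countable_lebesgue_measure0 cD)).
  - by move=> x /= /existsNP[q /negP]; rewrite negbK => /eqP xq; exists q.
move=> H; exact: (filter_forall (F := almost_everywhere (lebesgue_rV R n))
  (f := fun i x => forall q : rat, x ord0 i != ratr q) _ H).
Qed.

End Limit.

(** * Comparison of the supremum with the integral *)

Section Representation.
Context {R : realType} {n : nat}.
Variables (Omega : set 'rV[R]_n) (f g : 'rV[R]_n -> R) (d : R).
Hypotheses (oO : open Omega) (bO : bounded_set Omega) (gC1 : C1_closure Omega g).
Hypotheses (mf : measurable_fun setT f) (f0 : forall x, 0 <= f x) (d0 : 0 <= d).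
Hypothesis flsc : 0 < d ->
  {ae lebesgue_rV R n, forall x, Omega x -> lsc_at f x}.

Let mu := lebesgue_rV R n.
Let h (x : 'rV[R]_n) : R := f x `^ (2 * d).
Let h0 x : 0 <= h x. Proof. exact: powR_ge0. Qed.
Let gO : C1 Omega g. Proof. by case: gC1. Qed.
Let mO : measurable Omega. Proof. exact: open_measurable_rV. Qed.

(** For d = 0 the function [h] is constantly 1. For d > 0 the power is increasing, so a level t >= 0
    of [h] corresponds to the level t^(1/(2d)) of [f]; negative levels lie below [h] everywhere. *)
Lemma lsc_powR : {ae mu, forall x, Omega x -> lsc_at h x}.
Proof.
have [d00|dn0] := eqVneq d 0.
  apply: aeW => x _ t; rewrite /h d00 mulr0 powRr0 => t1.
  by apply: (filterE (F := nbhs x)) => y; rewrite powRr0.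
have dpos : 0 < d by rewrite lt_def dn0.
have d2 : 0 < 2 * d by rewrite mulr_gt0.
apply: filterS (flsc dpos) => x Hx Ox t th.
have [t0|t0] := ltP t 0.
  by apply: (filterE (F := nbhs x)) => y; exact: lt_le_trans t0 (h0 y).
have tE : (t `^ (2 * d)^-1) `^ (2 * d) = t.
  by rewrite -powRrM mulVf ?gt_eqF// powRr1.
have tf : t `^ (2 * d)^-1 < f x.
  rewrite ltNge; apply/negP => ft.
  have := ge0_ler_powR (ltW d2) (f0 x) (powR_ge0 _ _) ft.
  by rewrite tE leNgt th.
apply: filterS (Hx Ox _ tf) => y ty.
by rewrite -tE; apply: gt0_ltr_powR => //; rewrite nnegrE ?powR_ge0.
Qed.

Let mI : measurable_fun Omega (fun x => (enorm (grad g x) * h x)%:E).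
Proof.
apply/measurable_EFinP; apply: measurable_funM.
  apply: measurable_fun_continuous => // x Ox.
  by apply: continuous_at_enorm => i; exact: (continuous_grad gO Ox).
have mfO : measurable_fun Omega f by exact: measurable_funTS.
exact: (measurableT_comp (@measurable_powR R (2 * d)) mfO).
Qed.

Lemma pairing_le : (pairing Omega f g d <=
  \int[mu]_(x in Omega) (enorm (grad g x) * h x)%:E)%E.
Proof.
apply: ge_ereal_sup => _ [phi [phiC1 phif] <-].
have ig := integrable_gdot oO bO gC1 phiC1.
apply: (@le_trans _ _ (`|\int[mu]_(x in Omega) gdot g phi x|%:E)%E).
  by rewrite lee_fin ler_norm.
rewrite EFin_normr_Rintegral//.
have mg := measurable_int _ ig.
apply: le_trans (le_abse_integral _ mO mg) _.
apply: ge0_le_integral => //; first exact: measurableT_comp.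
move=> x Ox /=; rewrite lee_fin.
have dE : gdot g phi x = dotv (grad g x) (phi x).
  by apply: eq_bigr => i _; rewrite [grad _ _ _ _]mxE.
have : enorm (grad g x) * enorm (phi x) <= enorm (grad g x) * h x.
  by rewrite ler_wpM2l ?enorm_ge0 ?phif.
apply: le_trans; rewrite dE ler_norml dotv_le andbT lerNl.
have -> : - dotv (grad g x) (phi x) = dotv (grad g x) (- phi x).
  by rewrite -[- phi x]scaleN1r dotvZr mulN1r.
by rewrite -[enorm (phi x)]enormN dotv_le.
Qed.

Let F k m x := gdot g (gfield Omega g h k.+1%:R m.+1%:R^-1 m.+1%:R) x.

Let gfield_adm k m : admissible Omega f d (gfield Omega g h k.+1%:R m.+1%:R^-1 m.+1%:R).
Proof.
have k0 : 0 < k.+1%:R :> R by rewrite ltr0n.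
have m0 : 0 < m.+1%:R^-1 :> R by rewrite invr_gt0 ltr0n.
have m1 : m.+1%:R^-1 <= 1 :> R by rewrite invf_le1 ?ltr0n// ler1n.
split; first exact: gfield_C1c.
by move=> x _; exact: enorm_gfield.
Qed.

Let F_ge0 k m x : Omega x -> (0 <= (F k m x)%:E)%E.
Proof. by move=> _; rewrite lee_fin; apply: gdot_gfield_ge0. Qed.

Let iF k m : mu.-integrable Omega (EFin \o F k m).
Proof. by have [C _] := gfield_adm k m; exact: (integrable_gdot oO bO gC1 C). Qed.

Let mF k m : measurable_fun Omega (EFin \o F k m).
Proof. exact: measurable_int (iF k m). Qed.

Let intF k m : (\int[mu]_(x in Omega) (F k m x)%:E <= pairing Omega f g d)%E.
Proof.
rewrite -[leLHS]fineK; last exact: (integrable_fin_num mO (iF k m)).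
apply: ereal_sup_ubound.
by exists (gfield Omega g h k.+1%:R m.+1%:R^-1 m.+1%:R).
Qed.

(** The inner limit: the bumps fill the cubes at fixed mesh 1/(k+1). *)
Let L k x : \bar R := limn_einf (fun m => (F k m x)%:E).

Let L_ge0 k x : Omega x -> (0 <= L k x)%E.
Proof. by move=> Ox; apply: limn_einf_ge; apply: nearW => m; exact: F_ge0. Qed.

Let mL k : measurable_fun Omega (L k).
Proof. by apply: measurable_fun_limn_einf => m; exact: mF. Qed.

Let intL k : (\int[mu]_(x in Omega) L k x <= pairing Omega f g d)%E.
Proof.
apply: le_trans (fatou mu mO (mF k) (fun m x => @F_ge0 k m x)) _.
by apply: limn_einf_le => m; exact: intF.
Qed.

Lemma pairing_ge : (\int[mu]_(x in Omega) (enorm (grad g x) * h x)%:E <=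
  pairing Omega f g d)%E.
Proof.
have key : {ae mu, forall x, Omega x ->
    ((enorm (grad g x) * h x)%:E <= limn_einf (fun k => L k x))%E}.
  apply: filterS2 lsc_powR (@ae_irrational R n) => x Hx irr Ox.
  (* The slack [e] provides the strict inequality that [gvec_liminf] asks for. *)
  apply/lee_addgt0Pr => e e0; rewrite -leeBlDr//.
  apply: limn_einf_ge; rewrite -EFinB.
  have := @gvec_liminf _ _ Omega g h oO gO h0 x (enorm (grad g x) * h x - e) Ox (Hx Ox).
  rewrite gtrBl => /(_ e0); apply: filterS => k Hk.
  apply: limn_einf_ge.
  have k0 : 0 < k.+1%:R :> R by rewrite ltr0n.
  (* A point on a grid hyperplane would have a rational coordinate. *)
  have off i : k.+1%:R * x ord0 i != (gfloor k.+1%:R x i)%:~R.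
    apply: contra (irr i ((gfloor k.+1%:R x i)%:~R / k.+1%:R)) => /eqP kx.
    by rewrite fmorph_div/= ratr_int ratr_nat -kx mulrC mulKf// gt_eqF.
  apply: filterS (gdot_gfield_eventually Omega g h k0 off) => m Fm.
  by rewrite lee_fin /F Fm.
apply: (@le_trans _ _ (\int[mu]_(x in Omega) limn_einf (fun k => L k x))%E).
  apply: ae_ge0_le_integral => //.
  - by move=> x _; rewrite lee_fin mulr_ge0 ?enorm_ge0.
  - by move=> x Ox; apply: limn_einf_ge; apply: nearW => k; exact: L_ge0.
  - exact: measurable_fun_limn_einf.
apply: le_trans (fatou mu mO mL L_ge0) _.
by apply: limn_einf_le => k; exact: intL.
Qed.

End Representation.

(** The first conjunct rules out the default value: [PEACE_dis_of] selects a limit by [xget], which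
    would return 0 if there were none. *)
Theorem theorem6p2 (R : realType) (n : nat) (hn : (0 < n)%N)
  (Omega : set 'rV[R]_n) (hOmega : open Omega) (hbounded : bounded_set Omega)
  (disp : measure_display) (T : measurableType disp) (P : probability T R)
  (X : {RV P >-> 'rV[R]_n}) (hX : forall t, Omega (X t))
  (f : 'rV[R]_n -> R) (hf : is_pdf X f)
  (g : 'rV[R]_n -> R) (hg : C1_closure Omega g)
  (Y : T -> R) (hY : forall t, Y t = g (X t))
  (d : R) (hd : 0 <= d)
  (hlsc : 0 < d ->
    {ae lebesgue_rV R n, forall x, Omega x -> lsc_at f x})
  (C : (set 'rV[R]_n)^nat) (hC : admissible_cover Omega C) :
  (forall phi, admissible Omega f d phi ->
    exists l, is_PEACE_dis Omega g C phi l) /\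
  PEACE_dis Omega f g d C = PEACE Omega f g d /\
  PEACE Omega f g d =
    (\int[lebesgue_rV R n]_(x in Omega) (enorm (grad g x) * f x `^ (2 * d))%:E)%E.
Proof.
have [mf f0 _] := hf.
split.
  move=> phi [phiC1 _].
  exists (\int[lebesgue_rV R n]_(x in Omega) gdot g phi x).
  exact: gdot_is_PEACE_dis.
rewrite (PEACE_dis_pairing _ _ hOmega hbounded hg hC) (PEACE_pairing _ _ hOmega hbounded hg).
split=> //; apply/le_anti/andP; split; first exact: pairing_le.
exact: pairing_ge.
Qed.
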